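(* Let $1<p<\infty$, let $D$ be either the unit disc $\mathbf{U}$ or the complex plane $\mathbf{C}$, and let $\omega$ be a radially symmetric weight function on $D$. Let $X$ be a set (for example, a space with a norm), and let $A:X\to A_p(\omega)$ be a mapping (an operator, not necessarily linear). Assume that the operator $\mathrm{Re}\,A$, $x\mapsto\mathrm{Re}\,(Ax)$, which maps $X$ into $a_p(\omega)$, is bounded. Then the operator $A$ is also bounded. Moreover, there is an estimate with a universal constant: there exists a constant $c$ depending only on $p$ (not on $D$, $\omega$, $X$ or $A$) such that $\|A:X\to A_p(\omega)\|\le c\,\|\mathrm{Re}\,A:X\to a_p(\omega)\|$.
   Context: $\mathbf{U}=\{z\in\mathbf{C}:|z|<1\}$. A radially symmetric weight function on $D$ is a nonnegative measurable function $\omega$ on $D$ with $\omega(\zeta)=\omega(|\zeta|)$. For a measurable function $g$ on $D$, $\|g\|_{p,\omega}=\big(\int_D|g(\zeta)|^p\,\omega(\zeta)\,dA(\zeta)\big)^{1/p}$, where $dA$ is area measure. $A_p(\omega)$ is the space of all analytic functions $f$ on $D$ with $\|f\|_{p,\omega}<\infty$, and $a_p(\omega)$ is the space of real parts of functions in $A_p(\omega)$, equipped with $\|\cdot\|_{p,\omega}$. When $X$ is a space with norm $\|\cdot\|_X$, the norm of a (not necessarily linear) mapping $B$ from $X$ into one of these spaces is $\|B\|=\sup_{x\ne0}\|Bx\|_{p,\omega}/\|x\|_X$, and $B$ is called bounded if this is finite.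
   Formalization: As stated the claim fails (D=U, ω=1, X=R, Ax the constant function ix: Re A=0 but A≠0); the formal theorem adds the normalisation that Im (Ax)(0)=0 for every x in X. *)

(* Defs.v *)
From HB Require Import structures.
From mathcomp Require Import all_boot all_order all_algebra.
From mathcomp Require Import complex.
From mathcomp Require Import all_classical all_reals all_analysis.
Import Order.TTheory GRing.Theory Num.Theory.
Import numFieldNormedType.Exports.

Set Implicit Arguments.
Unset Strict Implicit.
Unset Printing Implicit Defensive.

Local Open Scope classical_set_scope.
Local Open Scope ring_scope.
Local Open Scope complex_scope.

(* Functions on a subset D of the complex plane are represented by total
   functions on R[i]; their values outside D are never used. *)

Section WeightedSpaces.
Variable R : realType.

Definition unit_disc : set R[i] := [set z | `|z| < 1].

Definition planar : R * R -> R[i] := fun xy => xy.1 +i* xy.2.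

Definition borel_area :
    {measure set (measurableTypeR R * measurableTypeR R)%type -> \bar R} :=
  (@lebesgue_measure R \x @lebesgue_measure R)%E.

Definition area_space := caratheodory_type (borel_area^*)%mu.

(* Two-dimensional Lebesgue measure, obtained by completing the product measure
   on the Borel sets; the measurable sets of [area_space] are the Lebesgue
   measurable subsets of R * R. *)
Definition area : {measure set area_space -> \bar R} :=
  @completed_measure_extension _ _ _ borel_area.

Definition radial_weight (D : set R[i]) (w : R[i] -> R) : Prop :=
  [/\ measurable_fun (planar @^-1` D : set area_space)
        (w \o planar : area_space -> R),
      forall z, D z -> 0 <= w z &
      forall z, D z -> w z = w `|z|].

(* [derivable] is taken over the field R[i], i.e. this is complex
   differentiability at every point of D. *)
Definition analytic (D : set R[i]) (f : R[i] -> R[i]) : Prop :=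
  forall z, D z -> derivable (f : R[i]^o -> R[i]^o) z 1.

Definition wnorm (p : R) (D : set R[i]) (w : R[i] -> R) (g : R[i] -> R[i]) :
    \bar R :=
  ((\int[area]_(xy in planar @^-1` D)
      (ComplexField.Normc.normc (g (planar xy)) `^ p *
       w (planar xy))%:E) `^ p^-1)%E.

Definition bergman (p : R) (D : set R[i]) (w : R[i] -> R) :
    set (R[i] -> R[i]) :=
  [set f | analytic D f /\ (wnorm p D w f < +oo)%E].

Definition re_part (f : R[i] -> R[i]) : R[i] -> R[i] :=
  fun z => (complex.Re (f z))%:C.

Definition re_bergman (p : R) (D : set R[i]) (w : R[i] -> R) :
    set (R[i] -> R[i]) :=
  [set re_part f | f in bergman p D w].

(* X is a set with a distinguished point x0 (the zero) and a size function N
   (the norm), so that a normed space V is the case x0 = 0, N = normr.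
   The supremum is taken in [0, +oo]: it is 0 when X = {x0}. *)
Definition op_norm (p : R) (D : set R[i]) (w : R[i] -> R)
    (X : Type) (x0 : X) (N : X -> R) (B : X -> R[i] -> R[i]) : \bar R :=
  ereal_sup (0%E |`
    [set (wnorm p D w (B x) * ((N x)^-1)%:E)%E | x in [set x | x <> x0]]).

Definition bounded_op (p : R) (D : set R[i]) (w : R[i] -> R)
    (X : Type) (x0 : X) (N : X -> R) (S : set (R[i] -> R[i]))
    (B : X -> R[i] -> R[i]) : Prop :=
  (forall x, S (B x)) /\ (op_norm p D w x0 N B < +oo)%E.

End WeightedSpaces.

(* Main.v *)
(** Everything reduces to a pointwise inequality for f analytic near a closed
    disc with f(0) real: the sums of |f|^p and of C |Re f|^p + e over the
    rotates of z by the N-th roots of unity are ordered, for N large.  The area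
    measure and the weight are invariant under these rotations, so the
    integrals against a bounded truncation of the weight are ordered as well;
    then e tends to 0 and the truncation is removed by monotone convergence.

    For the pointwise inequality one builds, for every p > 1, a subharmonic Phi
    with Phi(z) <= C (|Re z| + d)^p - |z|^p and Phi >= 0 on the real axis.  If
    p <= 2 this is Stein's function C |x|^p - |z|^p, smoothed; p is doubled by
    composing with the conformal map z |-> - i z^2.  The maximum principle for
    the rotation averages of Phi o f then gives what is needed.

    Subharmonicity is encoded as having, at every point, the real part of an
    analytic function as a local support from below.  Hence the only complex
    analysis required is that Re g cannot have a strict quadratic local maximum
    at a zero of g, which follows from Goursat's theorem in logarithmic polar
    coordinates. *)
Require Import Defs.
From mathcomp Require Import all_boot all_order all_algebra.
From mathcomp Require Import complex.
From mathcomp Require Import all_classical all_reals all_analysis.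
From mathcomp Require Import measurable_realfun ring lra.
Import Order.TTheory GRing.Theory Num.Theory.
Import numFieldNormedType.Exports.

Local Open Scope classical_set_scope.
Local Open Scope ring_scope.

(** The normalisation Im f(0) = 0 is essential: for a nonzero integrable weight the constant i has
    real part zero and positive norm. It enters through the sign of Phi at f(0).

    Sums over roots of unity stand in for circle means. They avoid polar coordinates in the area
    integral, since rotation invariance gives all N terms the same integral. Their price is the
    additive error e, which is harmless only against a finite mass; hence closed discs and bounded
    weights.

    For p <= 2 the Laplacian of |x|^p is p(p-1)|x|^(p-2), and this dominates p(p-1)|z|^(p-2) because
    |x| <= |z| and p - 2 <= 0; so a large C makes C|x|^p - |z|^p subharmonic. For p > 2 the
    comparison fails near the imaginary axis. The map z |-> -i z^2 turns |z|^p into |z|^(2p) and the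
    real part into 2xy, which is small against |z|^2 whenever x is small against |z|; this is what
    lets p be doubled. The shift d keeps the estimates away from the singularity of |x|^(p-2) at x =
    0. *)

Section Riesz.

Set Implicit Arguments.
Unset Strict Implicit.
Unset Printing Implicit Defensive.

Local Open Scope complex_scope.

(** * Goursat's theorem on rectangles, in real coordinates *)

Section Goursat.
Variable R : realType.
Local Notation mu := (@lebesgue_measure R).

Definition segint (g : R -> R) (a b : R) : R := \int[mu]_(x in `[a, b]) g x.

Definition contseg (g : R -> R) (a b : R) :=
  forall x, a <= x <= b -> {for x, continuous g}.

Lemma contseg_sub g a b c d :
  contseg g a b -> a <= c -> d <= b -> contseg g c d.
Proof.
by move=> cg ac db x /andP[cx xd]; apply: cg; rewrite (le_trans ac)//= (le_trans xd).
Qed.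

Lemma contseg_integrable g a b :
  contseg g a b -> mu.-integrable `[a, b] (EFin \o g).
Proof.
move=> cg; apply: continuous_compact_integrable; first exact: segment_compact.
apply: continuous_in_subspaceT => x; rewrite inE/= in_itv/= => xab.
exact: cg.
Qed.

Lemma contseg_sub_fun g h a b :
  contseg g a b -> contseg h a b -> contseg (fun x => g x - h x) a b.
Proof. by move=> cg ch x xab; apply: continuousB; [exact: cg|exact: ch]. Qed.

Lemma segint_split g a b c : contseg g a b -> a <= c -> c <= b ->
  segint g a b = segint g a c + segint g c b.
Proof.
move=> cg ac cb; rewrite /segint.
have -> : `[a, b]%classic = `[a, c] `|` `]c, b] by apply: itv_bndbnd_setU; rewrite bnd_simp.
have int_cb : mu.-integrable `]c, b] (EFin \o g).
  apply: (@integrableS _ _ _ mu `[c, b]) => //.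
    by apply: subset_itv; rewrite bnd_simp.
  by apply: contseg_integrable; apply: contseg_sub cg _ _.
rewrite Rintegral_setU//=.
- by rewrite Rintegral_itv_obnd_cbnd.
- rewrite -itv_bndbnd_setU ?bnd_simp//; exact: contseg_integrable.
- apply/disj_setPS => x [/=]; rewrite !in_itv/= => /andP[_ xc] /andP[cx _].
  by move: (le_lt_trans xc cx); rewrite ltxx.
Qed.

Lemma segint_sub g h a b : contseg g a b -> contseg h a b ->
  segint (fun x => g x - h x) a b = segint g a b - segint h a b.
Proof. by move=> cg ch; rewrite /segint RintegralB//; exact: contseg_integrable. Qed.

Lemma segint_cst k a b : a <= b -> segint (fun=> k) a b = k * (b - a).
Proof.
move=> ab; rewrite /segint Rintegral_cst//=.
rewrite lebesgue_measure_itv/= lte_fin; move: ab; rewrite le_eqVlt => /predU1P[->|->//].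
by rewrite ltxx subrr.
Qed.

Lemma segint_le g h a b : contseg g a b -> contseg h a b ->
  (forall x, a <= x <= b -> g x <= h x) -> segint g a b <= segint h a b.
Proof.
move=> cg ch gh; apply: le_Rintegral => //; try exact: contseg_integrable.
Qed.

Lemma segint_bound g k M a b : a <= b -> contseg g a b ->
  (forall x, a <= x <= b -> `|g x - k| <= M) ->
  `|segint g a b - k * (b - a)| <= M * (b - a).
Proof.
move=> ab cg gM; have cc c : contseg (fun=> c) a b by move=> x _; exact: cvg_cst.
have gM' x : a <= x <= b -> k - M <= g x <= k + M.
  by move=> /gM; rewrite ler_distl.
have h1 : segint (fun=> k - M) a b <= segint g a b.
  by apply: segint_le => // x /gM' /andP[].
have h2 : segint g a b <= segint (fun=> k + M) a b.
  by apply: segint_le => // x /gM' /andP[].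
by move: h1 h2; rewrite !segint_cst// ler_distl !mulrDl mulNr => -> ->.
Qed.

(* Rectangles are [s, s + h] x [t, t + k]; P sits in all rectangles of a nested
   sequence along which |J| >= e (h + k)^2 persists. *)
Lemma bisection (J : R -> R -> R -> R -> R) (S s0 t0 h0 k0 : R) :
  0 < h0 -> 0 < k0 -> s0 + h0 <= S ->
  (forall s t h k, 0 < h -> 0 < k -> s + h <= S ->
     J s t h k = J s t (h / 2) (k / 2) + J (s + h / 2) t (h / 2) (k / 2) +
       (J s (t + k / 2) (h / 2) (k / 2) +
        J (s + h / 2) (t + k / 2) (h / 2) (k / 2))) ->
  (forall x y e, x <= S -> 0 < e -> exists2 d, 0 < d &
     forall s t h k, 0 < h -> 0 < k -> s + h <= S ->
       s <= x <= s + h -> t <= y <= t + k -> h + k < d ->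
       `|J s t h k| <= e * (h + k) ^+ 2) ->
  J s0 t0 h0 k0 = 0.
Proof.
move=> h0p k0p hS Jadd Jsmall; apply/eqP/negP => /negP J0.
have hk0 : 0 < (h0 + k0) ^+ 2 by rewrite exprn_gt0 ?addr_gt0.
(* Half the initial ratio, so that the starting rectangle satisfies the strict inequality in [good].
   Halving both sides divides (h + k)^2 by 4, so one of the four children is good again. *)
pose e := `|J s0 t0 h0 k0| / (h0 + k0) ^+ 2 / 2.
have e0 : 0 < e by rewrite !divr_gt0 ?normr_gt0.
pose good (q : R * R * (R * R)) := [/\ 0 < q.2.1, 0 < q.2.2, q.1.1 + q.2.1 <= S &
  e * (q.2.1 + q.2.2) ^+ 2 < `|J q.1.1 q.1.2 q.2.1 q.2.2|].
pose child (q q' : R * R * (R * R)) :=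
  [/\ q'.2 = (q.2.1 / 2, q.2.2 / 2), good q' & [/\ q.1.1 <= q'.1.1,
      q'.1.1 + q'.2.1 <= q.1.1 + q.2.1,
      q.1.2 <= q'.1.2 & q'.1.2 + q'.2.2 <= q.1.2 + q.2.2]].
(* Quantified over all q, with a dummy answer for bad ones, so that choice yields a total
   function. *)
have step q : exists q', good q -> child q q'.
  case: (pselect (good q)) => [gq|]; last by exists q.
  case: q gq => [[s t] [h k]] [/= hp kp shS big].
  have h2 : 0 < h / 2 by rewrite divr_gt0.
  have k2 : 0 < k / 2 by rewrite divr_gt0.
  have [q [q1 q2 q3 q4 [q5 q6]]]: exists q : R * R, [/\ s <= q.1, q.1 + h / 2 <= s + h,
      t <= q.2, q.2 + k / 2 <= t + k &
      q.1 + h / 2 <= S /\ e * (h / 2 + k / 2) ^+ 2 < `|J q.1 q.2 (h / 2) (k / 2)|].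
    apply: contrapT => /forallNP nq.
    have small u v : s <= u -> u + h / 2 <= s + h -> t <= v -> v + k / 2 <= t + k ->
        `|J u v (h / 2) (k / 2)| <= e * (h / 2 + k / 2) ^+ 2.
      move=> su uh tv vk; rewrite leNgt; apply/negP => b.
      by apply: (nq (u, v)); split => //=; split => //; exact: le_trans shS.
    have s1 : `|J s t (h / 2) (k / 2)| <= e * (h / 2 + k / 2) ^+ 2 by apply: small; lra.
    have s2 : `|J (s + h / 2) t (h / 2) (k / 2)| <= e * (h / 2 + k / 2) ^+ 2.
      by apply: small; lra.
    have s3 : `|J s (t + k / 2) (h / 2) (k / 2)| <= e * (h / 2 + k / 2) ^+ 2.
      by apply: small; lra.
    have s4 : `|J (s + h / 2) (t + k / 2) (h / 2) (k / 2)| <= e * (h / 2 + k / 2) ^+ 2.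
      by apply: small; lra.
    move: big; rewrite Jadd// ltNge => /negP; apply.
    apply: (le_trans (ler_normD _ _)).
    apply: (le_trans (lerD (ler_normD _ _) (ler_normD _ _))).
    have -> : e * (h + k) ^+ 2 = e * (h / 2 + k / 2) ^+ 2 + e * (h / 2 + k / 2) ^+ 2 +
      (e * (h / 2 + k / 2) ^+ 2 + e * (h / 2 + k / 2) ^+ 2) by field.
    by rewrite !lerD.
  by exists (q, (h / 2, k / 2)) => _; split => //=; split.
have [next nextP] := choice step.
pose Q n := iter n next ((s0, t0), (h0, k0)).
have Q0 : good (Q 0%N).
  split => //=.
  have -> : e * (h0 + k0) ^+ 2 = `|J s0 t0 h0 k0| / 2.
    by rewrite /e mulrAC divfK ?gt_eqF.
  by rewrite ltr_pdivrMr// ltr_pMr ?normr_gt0// ltr1n.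
have Qg n : good (Q n).
  elim: n => [//|n IH]; rewrite /Q iterS -/(Q n).
  by have [] := nextP _ IH.
have Qc n : child (Q n) (Q n.+1) by rewrite {2}/Q iterS -/(Q n); exact: nextP.
have hn n : (Q n).2 = (h0 / 2 ^+ n, k0 / 2 ^+ n).
  elim: n => [|n IH]; first by rewrite /Q/= expr0 !divr1.
  by have [-> _ _] := Qc n; rewrite IH/= exprSr !invfM !mulrA.
have mono m n : (m <= n)%N -> [/\ (Q m).1.1 <= (Q n).1.1,
    (Q n).1.1 + (Q n).2.1 <= (Q m).1.1 + (Q m).2.1,
    (Q m).1.2 <= (Q n).1.2 & (Q n).1.2 + (Q n).2.2 <= (Q m).1.2 + (Q m).2.2].
  elim: n => [|n IH]; first by rewrite leqn0 => /eqP ->.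
  rewrite leq_eqVlt => /orP[/eqP-> //|]; rewrite ltnS => /IH[a1 a2 a3 a4].
  have [_ _ [b1 b2 b3 b4]] := Qc n.
  by split; [exact: le_trans b1|exact: le_trans a2|exact: le_trans b3|exact: le_trans a4].
(* Every left or lower edge lies below every right or upper edge, so the suprema of the former
   belong to all the rectangles. *)
have cross m n : (Q m).1.1 <= (Q n).1.1 + (Q n).2.1 /\
    (Q m).1.2 <= (Q n).1.2 + (Q n).2.2.
  have [hp kp _ _] := Qg m; have [hp' kp' _ _] := Qg n.
  by have [/mono[a b c d]|/ltnW/mono[a b c d]] := leqP m n; split; lra.
pose x := sup (range (fun n => (Q n).1.1)); pose y := sup (range (fun n => (Q n).1.2)).
have xP n : (Q n).1.1 <= x <= (Q n).1.1 + (Q n).2.1.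
  apply/andP; split.
    apply: ub_le_sup; last by exists n.
    by exists ((Q 0%N).1.1 + (Q 0%N).2.1) => _ [m _ <-]; have [] := cross m 0%N.
  apply: ge_sup; first by exists (Q 0%N).1.1; exists 0%N.
  by move=> _ [m _ <-]; have [] := cross m n.
have yP n : (Q n).1.2 <= y <= (Q n).1.2 + (Q n).2.2.
  apply/andP; split.
    apply: ub_le_sup; last by exists n.
    by exists ((Q 0%N).1.2 + (Q 0%N).2.2) => _ [m _ <-]; have [] := cross m 0%N.
  apply: ge_sup; first by exists (Q 0%N).1.2; exists 0%N.
  by move=> _ [m _ <-]; have [] := cross m n.
have xS : x <= S.
  by have /andP[_ /le_trans] := xP 0%N; apply; have [] := Qg 0%N.
have [d d0 dP] := Jsmall x y e xS e0.
have [n nd] : exists n : nat, (h0 + k0) / 2 ^+ n < d.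
  exists (Num.bound ((h0 + k0) / d)).
  rewrite ltr_pdivrMr ?exprn_gt0// mulrC -ltr_pdivrMr//.
  apply: (lt_trans (archi_boundP _)); first by rewrite divr_ge0 ?ltW ?addr_gt0.
  by rewrite -natrX ltr_nat ltn_expl.
have [hp kp sS big] := Qg n.
have := dP _ _ _ _ hp kp sS (xP n) (yP n).
rewrite {1}hn/= {1}hn/= -mulrDl => /(_ nd).
by rewrite leNgt big.
Qed.

(** Total differentiability of the pair (U, V), with derivative the multiplication by a + i b. The
    joint error bound is the form consumed by the estimate on small rectangles. *)
Definition cauchy_riemann (U V : R -> R -> R) (s t : R) :=
  exists ab : R * R, forall e, 0 < e -> exists2 d, 0 < d & forall x y,
    `|x - s| < d -> `|y - t| < d ->
    `|U x y - (U s t + (ab.1 * (x - s) - ab.2 * (y - t)))|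
        <= e * (`|x - s| + `|y - t|) /\
    `|V x y - (V s t + (ab.2 * (x - s) + ab.1 * (y - t)))|
        <= e * (`|x - s| + `|y - t|).

(* The imaginary part of the integral of (U + i V) (ds + i dt) along the
   boundary of a rectangle vanishes. *)
Lemma goursat (U V : R -> R -> R) (S s1 s2 t1 t2 : R) :
  s1 < s2 -> s2 <= S -> t1 < t2 ->
  (forall s t, s <= S -> {for s, continuous (U ^~ t)} /\ {for t, continuous (U s)}) ->
  (forall s t, s <= S -> {for s, continuous (V ^~ t)} /\ {for t, continuous (V s)}) ->
  (forall s t, s <= S -> cauchy_riemann U V s t) ->
  segint (U s2) t1 t2 - segint (U s1) t1 t2 =
  segint (V ^~ t2) s1 s2 - segint (V ^~ t1) s1 s2.
Proof.
move=> s12 s2S t12 cU cV CR.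
pose J s t h k := segint (U (s + h)) t (t + k) - segint (U s) t (t + k) -
  (segint (V ^~ (t + k)) s (s + h) - segint (V ^~ t) s (s + h)).
suff : J s1 t1 (s2 - s1) (t2 - t1) = 0.
  by rewrite /J !subrKC => /eqP; rewrite subr_eq0 => /eqP.
have cUt s t k : s <= S -> contseg (U s) t (t + k) by move=> sS x _; have [] := cU s x sS.
have cVs s t h : s + h <= S -> contseg (V ^~ t) s (s + h).
  by move=> sS x /andP[_ xh]; have [] := cV x t (le_trans xh sS).
apply: (@bisection J S); rewrite ?subr_gt0 ?subrKC//.
- move=> s t h k h0 k0 hS; rewrite /J.
  have hh : h / 2 + h / 2 = h by field.
  have kk : k / 2 + k / 2 = k by field.
  rewrite -![_ + h / 2 + h / 2]addrA -![_ + k / 2 + k / 2]addrA hh kk.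
  have shS : s + h / 2 <= S by lra.
  have sS : s <= S by lra.
  have eU x : x <= S -> segint (U x) t (t + k) =
      segint (U x) t (t + k / 2) + segint (U x) (t + k / 2) (t + k).
    by move=> xS; apply: segint_split; [exact: cUt|lra|lra].
  have eV y : segint (V ^~ y) s (s + h) =
      segint (V ^~ y) s (s + h / 2) + segint (V ^~ y) (s + h / 2) (s + h).
    by apply: segint_split; [exact: cVs|lra|lra].
  by rewrite !eU// !eV; ring.
- move=> x y e xS e0; have [[a b] abP] := CR x y xS.
  have e4 : 0 < e / 4 by rewrite divr_gt0.
  have [d d0 dP] := abP _ e4; exists d => //= s t h k h0 k0 hS /andP[sx xh] /andP[ty yk] hkd.
  have near u v : s <= u <= s + h -> t <= v <= t + k ->
      `|U u v - (U x y + (a * (u - x) - b * (v - y)))| <= e / 4 * (h + k) /\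
      `|V u v - (V x y + (b * (u - x) + a * (v - y)))| <= e / 4 * (h + k).
    move=> /andP[su uh] /andP[tv vk].
    have ux : `|u - x| <= h by rewrite ler_norml; lra.
    have vy : `|v - y| <= k by rewrite ler_norml; lra.
    have [||/= A B] := dP u v; [lra|lra|].
    by split; [apply: (le_trans A)|apply: (le_trans B)]; rewrite ler_pM2l// lerD.
  (* The affine parts contribute a h k to both integrals and cancel in [J]. Each difference of two
     values costs twice e / 4 (h + k), which leaves e (h + k)^2 / 2 in all. *)
  have i1 : `|segint (fun v => U (s + h) v - U s v) t (t + k) - a * h * (t + k - t)|
      <= (e / 2 * (h + k)) * (t + k - t).
    apply: segint_bound; first lra.
      by apply: contseg_sub_fun; apply: cUt; lra.
    move=> v vP.
    have [|A _] := near (s + h) v _ vP; first lra.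
    have [|B _] := near s v _ vP; first lra.
    by move: A B; rewrite !ler_norml; lra.
  have i2 : `|segint (fun u => V u (t + k) - V u t) s (s + h) - a * k * (s + h - s)|
      <= (e / 2 * (h + k)) * (s + h - s).
    apply: segint_bound; first lra.
      by apply: contseg_sub_fun; apply: cVs.
    move=> u uP.
    have [|_ A] := near u (t + k) uP; first lra.
    have [|_ B] := near u t uP; first lra.
    by move: A B; rewrite !ler_norml; lra.
  rewrite /J -!segint_sub; try (by apply: cUt; lra); try exact: cVs.
  move: i1 i2; set I1 := segint _ _ _; set I2 := segint _ _ _ => i1 i2.
  have -> : I1 - I2 = (I1 - a * h * (t + k - t)) - (I2 - a * k * (s + h - s)) by ring.
  apply: (le_trans (ler_normB _ _)); apply: (le_trans (lerD i1 i2)).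
  have ehk : 0 <= e * (h + k) ^+ 2 by rewrite mulr_ge0 ?sqr_ge0// ltW.
  have -> : e / 2 * (h + k) * (t + k - t) + e / 2 * (h + k) * (s + h - s) =
    e * (h + k) ^+ 2 / 2 by field.
  lra.
Qed.

End Goursat.

(** * Complex differentiability with real radii *)

Section ComplexDiff.
Variable R : realType.
Implicit Types (z w h : R[i]) (f g : R[i] -> R[i]).
Local Notation normc := (@ComplexField.Normc.normc R).

Lemma norm_normc z : `|z| = (normc z)%:C. Proof. by []. Qed.

Lemma normc_ge0 z : 0 <= normc z. Proof. by rewrite -lecR -norm_normc; exact: normr_ge0. Qed.

Lemma normcD z w : normc (z + w) <= normc z + normc w.
Proof. by rewrite -lecR rmorphD -!norm_normc ler_normD. Qed.

Lemma normc_opp z : normc (- z) = normc z.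
Proof. by apply: complexI; rewrite -!norm_normc normrN. Qed.

Lemma normcBC z w : normc (z - w) = normc (w - z).
Proof. by rewrite -normc_opp opprB. Qed.

Lemma normc_gt0 z : z != 0 -> 0 < normc z.
Proof. by move=> z0; rewrite -ltcR -norm_normc normr_gt0. Qed.

Lemma Re_le_normc z : `|complex.Re z| <= normc z.
Proof.
by case: z => a b /=; rewrite -sqrtr_sqr ler_wsqrtr// lerDl sqr_ge0.
Qed.

Lemma Im_le_normc z : `|complex.Im z| <= normc z.
Proof.
by case: z => a b /=; rewrite -sqrtr_sqr ler_wsqrtr// lerDr sqr_ge0.
Qed.

Lemma normc_le_ReIm z : normc z <= `|complex.Re z| + `|complex.Im z|.
Proof.
case: z => a b /=; rewrite -[leRHS]ger0_norm ?addr_ge0// -sqrtr_sqr ler_wsqrtr//.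
rewrite sqrrD !real_normK ?num_real// -addrA lerD2l lerDr mulrn_wge0// mulr_ge0//.
Qed.

Lemma normc_sqrE z : normc z ^+ 2 = complex.Re z ^+ 2 + complex.Im z ^+ 2.
Proof. by case: z => a b /=; rewrite sqr_sqrtr ?addr_ge0 ?sqr_ge0. Qed.

Lemma normc_real (x : R) : normc x%:C = `|x|.
Proof. by rewrite /= expr0n/= addr0 sqrtr_sqr. Qed.

(** Free of division, so h = 0 is admissible, and stated with real radii, whereas the norm of [R[i]]
    takes its values in [R[i]]. *)
Definition cdiff f z := exists l, forall e : R, 0 < e -> exists2 d : R, 0 < d &
  forall h, normc h < d -> normc (f (z + h) - f z - l * h) <= e * normc h.

Lemma derivable_cdiff f z : derivable (f : R[i]^o -> R[i]^o) z 1 -> cdiff f z.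
Proof.
rewrite /derivable => /cvg_ex[l /= /cvg_ballP H].
exists l => e e0; have e0' : 0 < e%:C by rewrite ltcR.
have := H _ e0'; rewrite near_withinE => /nbhs_ballP[d' /= d'0 dP].
(* Positivity in [R[i]] forces a zero imaginary part, so the radius [d'] is real. *)
have [d d0 dE] : exists2 d : R, 0 < d & d' = d%:C.
  move: d'0; rewrite ltcE/= => /andP[/eqP i0 r0]; exists (complex.Re d') => //.
  by move: i0; case: (d') => a b /= ->.
exists d => // h hd; have [->|h0] := eqVneq h 0.
  by rewrite addr0 subrr mulr0 subr0 ComplexField.Normc.normc0 mulr0.
have := dP h; rewrite /ball/= sub0r normrN norm_normc dE ltcR => /(_ hd h0).
rewrite norm_normc ltcR => /ltW le.
have -> : f (z + h) - f z - l * h = - (l - h^-1 *: (f (h%:A + z) - f z)) * h.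
  rewrite /GRing.scale/= mulr1 [h + z]addrC mulNr mulrBl mulrAC mulVf// mul1r opprB.
  by [].
by rewrite ComplexField.Normc.normcM normc_opp ler_wpM2r// normc_ge0.
Qed.

Lemma cdiff_cst c z : cdiff (fun=> c) z.
Proof.
exists 0 => e e0; exists 1 => // h _.
by rewrite subrr mul0r subr0 ComplexField.Normc.normc0 mulr_ge0 ?normc_ge0 ?ltW.
Qed.

Lemma cdiff_id z : cdiff id z.
Proof.
exists 1 => e e0; exists 1 => // h _.
have -> : id (z + h) - id z - 1 * h = 0 by rewrite /=; ring.
by rewrite ComplexField.Normc.normc0 mulr_ge0 ?normc_ge0 ?ltW.
Qed.

Lemma cdiffD f g z : cdiff f z -> cdiff g z -> cdiff (fun z => f z + g z) z.
Proof.
move=> [a fP] [b gP]; exists (a + b) => e e0.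
have e2 : 0 < e / 2 by rewrite divr_gt0.
have [d d0 dP] := fP _ e2; have [d' d0' dP'] := gP _ e2.
exists (Num.min d d'); first by rewrite lt_min d0.
move=> h; rewrite lt_min => /andP[/dP A /dP' B].
have -> : f (z + h) + g (z + h) - (f z + g z) - (a + b) * h =
  (f (z + h) - f z - a * h) + (g (z + h) - g z - b * h) by ring.
by apply: (le_trans (normcD _ _)); rewrite (splitr e) mulrDl lerD.
Qed.

Lemma cdiff_lip f z : cdiff f z -> exists2 L : R, 0 < L & exists2 d : R, 0 < d &
  forall h, normc h < d -> normc (f (z + h) - f z) <= L * normc h.
Proof.
move=> [l fP]; exists (normc l + 1); first by rewrite ltr_wpDl ?normc_ge0.
have [d d0 dP] := fP 1 ltr01; exists d => // h /dP A.
have -> : f (z + h) - f z = (f (z + h) - f z - l * h) + l * h by rewrite subrK.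
apply: (le_trans (normcD _ _)); rewrite ComplexField.Normc.normcM addrC mulrDl.
by rewrite lerD2l.
Qed.

Lemma cdiff_continuous f z : cdiff f z -> forall e : R, 0 < e -> exists2 d : R, 0 < d &
  forall w, normc (w - z) < d -> normc (f w - f z) < e.
Proof.
move=> /cdiff_lip[L L0 [d d0 dP]] e e0.
exists (Num.min d (e / L)); first by rewrite lt_min d0 divr_gt0.
move=> w; rewrite lt_min => /andP[/dP]; rewrite subrKC => A B.
by apply: (le_lt_trans A); rewrite mulrC -ltr_pdivlMr.
Qed.

Lemma cdiff_comp f g z : cdiff f z -> cdiff g (f z) -> cdiff (g \o f) z.
Proof.
move=> df [b gP]; have [L L0 [d d0 dP]] := cdiff_lip df.
case: df => a fP; exists (b * a) => e e0.
have e1 : 0 < e / 2 / (normc b + 1) by rewrite !divr_gt0// ltr_wpDl ?normc_ge0.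
have e2 : 0 < e / 2 / L by rewrite !divr_gt0.
have [d1 d10 d1P] := fP _ e1; have [d2 d20 d2P] := gP _ e2.
exists (Num.min d (Num.min d1 (d2 / L))); first by rewrite !lt_min d0 d10 divr_gt0.
move=> h; rewrite !lt_min => /and3P[hd hd1 hd2].
have A := dP _ hd; have B := d1P _ hd1.
have : normc (f (z + h) - f z) < d2.
  by apply: (le_lt_trans A); rewrite mulrC -ltr_pdivlMr.
move=> /d2P; rewrite subrKC => C.
have -> : (g \o f) (z + h) - (g \o f) z - b * a * h =
  (g (f (z + h)) - g (f z) - b * (f (z + h) - f z)) +
  b * (f (z + h) - f z - a * h) by rewrite /=; ring.
apply: (le_trans (normcD _ _)); rewrite (splitr e) mulrDl lerD//.
  apply: (le_trans C); apply: (le_trans (ler_wpM2l (ltW e2) A)).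
  by rewrite mulrA divfK ?gt_eqF.
rewrite ComplexField.Normc.normcM.
apply: (le_trans (ler_wpM2l (normc_ge0 _) B)); rewrite mulrA ler_wpM2r ?normc_ge0//.
rewrite mulrC -[X in X <= _]mulrA ger_pMr ?divr_gt0//.
by rewrite mulrC ler_pdivrMr ?mul1r ?lerDl// ltr_wpDl ?normc_ge0.
Qed.

Lemma cdiffMc f c z : cdiff f z -> cdiff (fun z => c * f z) z.
Proof.
move=> df; apply: (cdiff_comp df (g := fun w => c * w)).
exists c => e e0; exists 1 => // h _.
have -> : c * (f z + h) - c * f z - c * h = 0 by ring.
by rewrite ComplexField.Normc.normc0 mulr_ge0 ?normc_ge0 ?ltW.
Qed.

Lemma cdiff_sqr f z : cdiff f z -> cdiff (fun z => f z ^+ 2) z.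
Proof.
move=> df; apply: (cdiff_comp df (g := fun w => w ^+ 2)).
exists (2 * f z) => e e0; exists e => // h /ltW he.
have -> : (f z + h) ^+ 2 - f z ^+ 2 - 2 * f z * h = h * h by ring.
by rewrite ComplexField.Normc.normcM ler_wpM2r// normc_ge0.
Qed.

End ComplexDiff.

(** * The exponential map, and the absence of strict local maxima *)

Section LocalMaximum.
Variable R : realType.
Implicit Types (z w h : R[i]) (f g : R[i] -> R[i]).
Local Notation normc := (@ComplexField.Normc.normc R).

Lemma is_derive_lin (f : R -> R) (x l : R) : is_derive x (1 : R) f l ->
  forall e : R, 0 < e -> exists2 d : R, 0 < d & forall h : R, `|h| < d ->
    `|f (x + h) - f x - l * h| <= e * `|h|.
Proof.
move=> [/derivable_nbhs df dl] e e0.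
move: df; rewrite dl => /eqaddoP/(_ e e0)/nbhs_ballP[d /= d0 dP].
exists d => // h hd.
have := dP h; rewrite /ball/= sub0r normrN => /(_ hd).
rewrite !fctE/=.
have -> : (h%:A : R^o) = h by rewrite /GRing.scale/= mulr1.
by rewrite [h + x]addrC opprD addrA [l * h]mulrC.
Qed.

Definition cexp z : R[i] :=
  (expR (complex.Re z) * cos (complex.Im z)) +i*
  (expR (complex.Re z) * sin (complex.Im z)).

Lemma cexpD z w : cexp (z + w) = cexp z * cexp w.
Proof.
case: z w => [a b] [c d]; apply/eqP; rewrite eq_complex /=.
by rewrite expRD cosD sinD; apply/andP; split; apply/eqP; ring.
Qed.

Lemma normc_cexp z : normc (cexp z) = expR (complex.Re z).
Proof.
case: z => a b; rewrite /= !exprMn -mulrDr cos2Dsin2 mulr1 sqrtr_sqr.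
by rewrite ger0_norm// expR_ge0.
Qed.

Lemma cexp0 : cexp 0 = 1.
Proof. by rewrite /cexp /= expR0 cos0 sin0 !mul1r. Qed.

Lemma cexp_lin e : 0 < e -> exists2 d : R, 0 < d &
  forall h, normc h < d -> normc (cexp h - 1 - h) <= e * normc h.
Proof.
(* With e / 12 the errors add up to 3 e / 12 in the real part and 5 e / 12 in the imaginary part,
   both below e / 2. Since [e'] is also one of the radii for [h], it bounds |x| as well. *)
move=> e0; have [e' [e'0 e'1 e'6]] : exists e' : R, [/\ 0 < e', e' <= 1 & e' <= e / 12].
  exists (Num.min 1 (e / 12)); split; last 2 first.
  - by rewrite ge_min lexx.
  - by rewrite ge_min lexx orbT.
  - by rewrite lt_min ltr01 divr_gt0.
have [d1 d10 A] := is_derive_lin (is_derive_expR 0) e'0.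
have [d2 d20 B] := is_derive_lin (is_derive_cos 0) e'0.
have [d3 d30 C] := is_derive_lin (is_derive_sin 0) e'0.
exists (Num.min e' (Num.min d1 (Num.min d2 d3))); first by rewrite !lt_min e'0 d10 d20.
move=> h; rewrite !lt_min => /and4P[he h1 h2 h3].
have := Re_le_normc h; have := Im_le_normc h.
case: h he h1 h2 h3 => x y; set n := normc _ => he h1 h2 h3 yn xn.
rewrite [complex.Im _]/= in yn; rewrite [complex.Re _]/= in xn.
have {A} := A x (le_lt_trans xn h1); rewrite add0r expR0 mul1r => A.
have {B} := B y (le_lt_trans yn h2).
rewrite add0r cos0 sin0 oppr0 mul0r subr0 => B.
have {C} := C y (le_lt_trans yn h3).
rewrite add0r cos0 sin0 mul1r subr0 => C.
apply: (le_trans (normc_le_ReIm _)) => /=.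
have n0 : 0 <= n by exact: normc_ge0.
have en (m : R) : `|m| <= n -> e' * `|m| <= e / 12 * n.
  by move=> mn; rewrite ler_pM// ltW.
have xe : `|x| <= e' by rewrite (le_trans xn)// ltW.
have re : `|expR x * cos y - 1 - x| <= e / 2 * n.
  have -> : expR x * cos y - 1 - x =
    (expR x - 1 - x) * cos y + (1 + x) * (cos y - 1) by ring.
  apply: (le_trans (ler_normD _ _)); rewrite !normrM.
  have en0 : 0 <= e * n by rewrite mulr_ge0// ltW.
  have c1 : `|expR x - 1 - x| * `|cos y| <= e / 12 * n.
    apply: (@le_trans _ _ (`|expR x - 1 - x|)); last exact: le_trans A (en _ xn).
    by rewrite ler_piMr// ler_norml cos_geN1 cos_le1.
  have c2 : `|1 + x| * `|cos y - 1| <= 2 * (e / 12 * n).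
    apply: ler_pM => //; last exact: le_trans B (en _ yn).
    by rewrite (le_trans (ler_normD _ _))// normr1 lerD2l (le_trans xe).
  lra.
have im : `|expR x * sin y - 0 - y| <= e / 2 * n.
  have -> : expR x * sin y - 0 - y = (sin y - y) + (expR x - 1) * sin y by ring.
  apply: (le_trans (ler_normD _ _)); rewrite normrM.
  have c1 : `|sin y - y| <= e / 12 * n by exact: le_trans C (en _ yn).
  have ex : `|expR x - 1| <= 2 * (e / 12).
    have -> : expR x - 1 = (expR x - 1 - x) + x by ring.
    apply: (le_trans (ler_normD _ _)).
    have : e' * `|x| <= `|x| by rewrite ler_piMl.
    lra.
  have sy : `|sin y| <= 2 * n.
    have -> : sin y = (sin y - y) + y by ring.
    apply: (le_trans (ler_normD _ _)).
    have : e' * `|y| <= `|y| by rewrite ler_piMl.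
    lra.
  have c2 : `|expR x - 1| * `|sin y| <= 2 * (e / 12) * (2 * n) by exact: ler_pM.
  have : 0 <= e * n by rewrite mulr_ge0// ltW.
  lra.
rewrite (splitr e) mulrDl; exact: lerD.
Qed.

Lemma cdiff_cexp z : cdiff cexp z.
Proof.
exists (cexp z) => e e0.
have e1 : 0 < e / normc (cexp z) by rewrite divr_gt0// normc_cexp expR_gt0.
have [d d0 dP] := cexp_lin e1; exists d => // h /dP A.
have -> : cexp (z + h) - cexp z - cexp z * h = cexp z * (cexp h - 1 - h).
  by rewrite cexpD; ring.
rewrite ComplexField.Normc.normcM mulrC -ler_pdivlMr; last by rewrite normc_cexp expR_gt0.
by rewrite mulrAC.
Qed.

Lemma cdiff_cauchy_riemann f (s t : R) : cdiff f (s +i* t) ->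
  cauchy_riemann (fun x y => complex.Re (f (x +i* y)))
                 (fun x y => complex.Im (f (x +i* y))) s t.
Proof.
move=> [[a b] fP]; exists (a, b) => e e0; have [d d0 dP] := fP _ e0.
exists (d / 2); first by rewrite divr_gt0.
move=> x y xd yd; set h := (x - s) +i* (y - t).
have nh : normc h <= `|x - s| + `|y - t| by exact: (normc_le_ReIm h).
have := dP h (le_lt_trans nh _).
rewrite (splitr d) ltrD// => /(_ isT) A.
have eh : s +i* t + h = x +i* y.
  by apply/eqP; rewrite eq_complex /= !subrKC !eqxx.
rewrite eh in A.
have B : e * normc h <= e * (`|x - s| + `|y - t|) by rewrite ler_pM2l.
split; (apply: le_trans B); apply: le_trans A.
- apply: (le_trans _ (Re_le_normc _)).
  case: (f (x +i* y)) (f (s +i* t)) => [p q] [p' q'] /=.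
  by rewrite le_eqVlt; apply/orP; left; apply/eqP; congr `|_|; ring.
- apply: (le_trans _ (Im_le_normc _)).
  case: (f (x +i* y)) (f (s +i* t)) => [p q] [p' q'] /=.
  by rewrite le_eqVlt; apply/orP; left; apply/eqP; congr `|_|; ring.
Qed.

Lemma cauchy_riemann_continuous (U V : R -> R -> R) s t : cauchy_riemann U V s t ->
  ({for s, continuous (U ^~ t)} /\ {for t, continuous (U s)}) /\
  ({for s, continuous (V ^~ t)} /\ {for t, continuous (V s)}).
Proof.
move=> [[a b] /(_ 1 ltr01)[d d0 /= dP]].
pose L : R := `|a| + `|b| + 1.
have L0 : 0 < L by rewrite ltr_wpDl.
have bnd (W : R -> R -> R) (p q x y : R) : `|p| <= `|a| + `|b| -> `|q| <= `|a| + `|b| ->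
   `|W x y - (W s t + (p * (x - s) + q * (y - t)))| <= 1 * (`|x - s| + `|y - t|) ->
   `|W x y - W s t| <= L * (`|x - s| + `|y - t|).
  move=> pL qL; rewrite mul1r => A.
  have -> : W x y - W s t = (W x y - (W s t + (p * (x - s) + q * (y - t)))) +
    (p * (x - s) + q * (y - t)) by ring.
  apply: (le_trans (ler_normD _ _)); rewrite /L mulrDl mul1r addrC lerD//.
  apply: (le_trans (ler_normD _ _)); rewrite !normrM mulrDr.
  by rewrite lerD// ler_wpM2r.
have cont (w : R -> R) (x0 : R) : (forall x : R, `|x - x0| < d -> `|w x - w x0| <= L * `|x - x0|) ->
    {for x0, continuous w}.
  move=> wL; apply/cvgrPdist_lt => e e0.
  apply/nbhs_ballP; exists (Num.min d (e / L)); first by rewrite /= lt_min d0 divr_gt0.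
  move=> x; rewrite /ball/= distrC lt_min => /andP[/wL A B]; rewrite distrC.
  by apply: (le_lt_trans A); rewrite mulrC -ltr_pdivlMr.
have N (p : R) : `|p| <= `|a| + `|b| -> `|- p| <= `|a| + `|b| by rewrite normrN.
have aL : `|a| <= `|a| + `|b| by rewrite lerDl.
have bL : `|b| <= `|a| + `|b| by rewrite lerDr.
split; split; apply: cont => x xd.
- have [|A _] := dP x t xd; first by rewrite subrr normr0.
  have := bnd U a (- b) x t aL (N _ bL); rewrite mulNr subrr normr0 addr0.
  by rewrite subrr normr0 addr0 in A; apply.
- have [|A _] := dP s x _ xd; first by rewrite subrr normr0.
  have := bnd U a (- b) s x aL (N _ bL); rewrite mulNr subrr normr0 add0r.
  by rewrite subrr normr0 add0r in A; apply.
- have [|_ A] := dP x t xd; first by rewrite subrr normr0.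
  have := bnd V b a x t bL aL; rewrite subrr normr0 addr0.
  by rewrite subrr normr0 addr0 in A; apply.
- have [|_ A] := dP s x _ xd; first by rewrite subrr normr0.
  have := bnd V b a s x bL aL; rewrite subrr normr0 add0r.
  by rewrite subrr normr0 add0r in A; apply.
Qed.

End LocalMaximum.

Section LocalMaximum2.
Variable R : realType.
Implicit Types (z w h : R[i]) (f g : R[i] -> R[i]).
Local Notation normc := (@ComplexField.Normc.normc R).

(** Circle means of Re g do not depend on the radius: in the coordinates z0 + exp(s + i t) the
    horizontal sides of Goursat's rectangle agree by periodicity. On the circle of radius r / 2 the
    mean is at most -d (r / 2)^2, while on small circles it is close to Re g(z0) = 0. The centre
    itself corresponds to s = -oo and is never reached. *)
Lemma no_strict_local_max g z0 (r d : R) : 0 < r -> 0 < d ->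
  (forall z, normc (z - z0) < r -> cdiff g z) -> g z0 = 0 ->
  (forall z, normc (z - z0) < r -> complex.Re (g z) <= - d * normc (z - z0) ^+ 2) ->
  False.
Proof.
move=> r0 d0 dg g0 gmax.
pose F z := g (z0 + cexp z).
pose S := ln (r / 2).
have r2 : 0 < r / 2 by rewrite divr_gt0.
have nE s t : normc (z0 + cexp (s +i* t) - z0) = expR s.
  by rewrite addrAC subrr add0r normc_cexp.
have eS : expR S = r / 2 by rewrite lnK// posrE.
have inr s t : s <= S -> normc (z0 + cexp (s +i* t) - z0) < r.
  by rewrite nE -ler_expR eS => /le_lt_trans; apply; lra.
have dF s t : s <= S -> cdiff F (s +i* t).
  move=> sS; apply: (cdiff_comp (f := fun z => z0 + cexp z)).
    by apply: cdiffD; [exact: cdiff_cst|exact: cdiff_cexp].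
  exact/dg/inr.
have CR s t sS := cdiff_cauchy_riemann (dF s t sS).
pose U x y := complex.Re (F (x +i* y)); pose V x y := complex.Im (F (x +i* y)).
have cU s t (sS : s <= S) : {for s, continuous (U ^~ t)} /\ {for t, continuous (U s)}.
  by have [] := cauchy_riemann_continuous (CR s t sS).
have cV s t (sS : s <= S) : {for s, continuous (V ^~ t)} /\ {for t, continuous (V s)}.
  by have [] := cauchy_riemann_continuous (CR s t sS).
have pi0 : 0 < pi *+ 2 :> R by rewrite mulrn_wgt0// pi_gt0.
have per s : F (s +i* (pi *+ 2)) = F (s +i* 0).
  by rewrite /F /cexp /= cos2pi sin2pi cos0 sin0.
have cst s1 : s1 < S -> segint (U S) 0 (pi *+ 2) = segint (U s1) 0 (pi *+ 2).
  move=> s1S; apply/eqP; rewrite -subr_eq0.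
  rewrite (@goursat _ U V S)//.
  have -> : V ^~ (pi *+ 2) = V ^~ 0 by apply/funext => s; rewrite /V per.
  by rewrite subrr.
have contU s (sS : s <= S) : contseg (U s) 0 (pi *+ 2) by move=> t _; have [] := cU s t sS.
pose e := d * (r / 2) ^+ 2.
have e0 : 0 < e by rewrite mulr_gt0// exprn_gt0.
have up : segint (U S) 0 (pi *+ 2) <= - e * (pi *+ 2).
  rewrite -[X in _ * X]subr0 -segint_cst ?(ltW pi0)//.
  apply: segint_le => //; [exact: contU|by move=> x _; exact: cvg_cst|].
  by move=> t _; apply: (le_trans (gmax _ (inr S t (lexx S)))); rewrite nE eS mulNr.
have dg0 : cdiff g z0 by apply: dg; rewrite subrr ComplexField.Normc.normc0.
have [d1 d10 d1P] := cdiff_continuous dg0 (divr_gt0 e0 (ltr0Sn _ 1)).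
pose s1 := Num.min (S - 1) (ln (d1 / 2)).
have s1S : s1 < S by rewrite gt_min ltrBlDr ltrDl ltr01.
have s1d : expR s1 < d1.
  apply: (@le_lt_trans _ _ (d1 / 2)); last lra.
  by rewrite -[leRHS]lnK ?posrE ?divr_gt0// ler_expR ge_min lexx orbT.
have lo : - (e / 2) * (pi *+ 2) <= segint (U s1) 0 (pi *+ 2).
  rewrite -[X in _ * X]subr0 -segint_cst ?(ltW pi0)//.
  apply: segint_le; [by move=> x _; exact: cvg_cst|by apply: contU; exact: ltW|].
  move=> t _; have := d1P (z0 + cexp (s1 +i* t)); rewrite nE g0 subr0 => /(_ s1d) A.
  have := le_lt_trans (Re_le_normc _) A; rewrite ltr_norml => /andP[B _].
  exact: ltW B.
have := le_trans lo (le_trans _ up); rewrite (cst _ s1S) => /(_ (lexx _)).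
by rewrite (ler_pM2r pi0) lerN2 leNgt ltr_pdivrMr// ltr_pMr// ltr1n.
Qed.

End LocalMaximum2.

Local Arguments ComplexField.Normc.normc : simpl never.

(** * Subharmonicity by local supports, and the maximum principle *)

Section MaximumPrinciple.
Variable R : realType.
Implicit Types (z w h : R[i]) (f g : R[i] -> R[i]) (G H : R[i] -> R).
Local Notation normc := (@ComplexField.Normc.normc R).

Definition cctn G z := forall e : R, 0 < e -> exists2 d : R, 0 < d &
  forall w, normc (w - z) < d -> `|G w - G z| < e.

Lemma cctn_add G H z : cctn G z -> cctn H z -> cctn (fun z => G z + H z) z.
Proof.
move=> cG cH e e0; have e2 : 0 < e / 2 by rewrite divr_gt0.
have [d d0 dP] := cG _ e2; have [d' d'0 d'P] := cH _ e2.
exists (Num.min d d'); first by rewrite lt_min d0.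
move=> w; rewrite lt_min => /andP[/dP A /d'P B].
by rewrite opprD addrACA (splitr e) (le_lt_trans (ler_normD _ _))// ltrD.
Qed.

Lemma cctn_cst c z : cctn (fun=> c) z.
Proof. by move=> e e0; exists 1 => // w _; rewrite subrr normr0. Qed.

Lemma cctn_sum (I : Type) (s : seq I) (F : I -> R[i] -> R) z :
  (forall i, cctn (F i) z) -> cctn (fun z => \sum_(i <- s) F i z) z.
Proof.
move=> FP; elim: s => [|i s IH].
  by under eq_fun do rewrite big_nil; exact: cctn_cst.
by under eq_fun do rewrite big_cons; exact: cctn_add.
Qed.

Lemma near_planar (x : R * R) (d : R) : 0 < d ->
  \forall y \near x, normc (planar y - planar x) < d.
Proof.
move=> d0; apply/nbhs_ballP; exists (d / 2) => /=; first by rewrite divr_gt0.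
move=> y [/= b1 b2]; move: b1 b2; rewrite /ball/= => b1 b2.
apply: (le_lt_trans (normc_le_ReIm _)) => /=; rewrite (splitr d).
by rewrite ltrD// distrC.
Qed.

(** Taken in R * R, which serves both for compactness and for the area measure. *)
Definition cdisk (r : R) : set (R * R) := [set x | normc (planar x) <= r].

Lemma compact_cdisk r : compact (cdisk r).
Proof.
pose sq := `[(- r)%R, r]%classic `*` `[(- r)%R, r]%classic : set (R * R).
have csq : compact sq by apply: compact_setX; exact: segment_compact.
apply: (subclosed_compact _ csq).
  rewrite (_ : cdisk r = ~` [set x | r < normc (planar x)]); last first.
    by apply/seteqP; split => x /=; rewrite /cdisk/= leNgt => /negP.
  apply: open_closedC; rewrite openE => x /= rx.
  have d0 : 0 < normc (planar x) - r by rewrite subr_gt0.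
  apply: filterS (near_planar x d0) => y /=.
  have := normcD (planar x - planar y) (planar y); rewrite subrK normcBC; lra.
move=> [x y] /= xr.
have := le_trans (Re_le_normc _) xr; have := le_trans (Im_le_normc _) xr;
  by rewrite !ler_norml/= => yr xr'; split; rewrite /= in_itv.
Qed.

Lemma cctn_EVT G r : 0 <= r -> (forall z, normc z <= r -> cctn G z) ->
  exists2 z0, normc z0 <= r & forall z, normc z <= r -> G z <= G z0.
Proof.
move=> r0 cG.
have [|||[x y]] := @compact_EVT_max _ R (G \o @planar R) (cdisk r).
- by exists (0, 0); rewrite /cdisk/= /planar/= ComplexField.Normc.normc0.
- exact: compact_cdisk.
- apply: continuous_in_subspaceT => x; rewrite inE => xr.
  apply/cvgrPdist_lt => e e0; have [d d0 dP] := cG _ xr _ e0.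
  by apply: filterS (near_planar x d0) => w /dP; rewrite distrC.
rewrite inE => xr xmax; exists (planar (x, y)) => // -[a b] ab.
by apply: (xmax (a, b)); rewrite inE.
Qed.

(** Near each point the radius 1 / (n + 1) works for all large n, and the near-covering form of
    compactness makes n uniform. Uniformity matters because all N rotates of a point are moved at
    once in [rot_sum_ge]. *)
Lemma cctn_uniform G r : (forall z, normc z <= r -> cctn G z) ->
  forall e : R, 0 < e -> exists2 d : R, 0 < d & forall z w, normc z <= r -> normc w <= r ->
    normc (w - z) < d -> `|G w - G z| < e.
Proof.
move=> cG e e0.
pose P (n : nat) (x : R * R) := normc (planar x) <= r -> forall w, normc w <= r ->
  normc (w - planar x) < n.+1%:R^-1 -> `|G w - G (planar x)| < e.
have : \forall n \near \oo, cdisk r `<=` P n.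
  apply: (iffLR (compact_near_coveringP _) (@compact_cdisk r)) => x xr.
  have e2 : 0 < e / 2 by rewrite divr_gt0.
  have [d d0 dP] := cG _ xr _ e2.
  have d2 : 0 < d / 2 by rewrite divr_gt0.
  near=> y n => yr w wr wy.
  have yx : normc (planar y - planar x) < d / 2 by near: y; exact: near_planar.
  have nd : n.+1%:R^-1 < d / 2 :> R by near: n; exact: near_infty_natSinv_lt (PosNum d2).
  have -> : G w - G (planar y) = (G w - G (planar x)) + (G (planar x) - G (planar y)) by ring.
  rewrite (splitr e) (le_lt_trans (ler_normD _ _))// ltrD//.
    apply: dP; have {wy nd} wy := lt_trans wy nd.
    have := normcD (w - planar y) (planar y - planar x); rewrite subrKA; lra.
  by rewrite distrC; apply: dP; apply: (lt_trans yx); rewrite ltr_pdivrMr// ltr_pMr// ltr1n.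
move=> [n _ /(_ n (leqnn n)) nP]; exists n.+1%:R^-1; first by rewrite invr_gt0.
by move=> [a b] w zr wr /(nP (a, b) zr zr w wr).
Unshelve. all: by end_near. Qed.

(** Supports add up, scale by nonnegative factors and pull back along analytic maps, which gives all
    closure properties without Laplacians or mean values. *)
Definition subharmonic_at H z0 := exists g, exists2 r : R, 0 < r &
  [/\ g z0 = 0, forall z, normc (z - z0) < r -> cdiff g z &
      forall z, normc (z - z0) < r -> H z0 + complex.Re (g z) <= H z].

Lemma ReD z w : complex.Re (z + w) = complex.Re z + complex.Re w.
Proof. by case: z w => [? ?] [? ?]. Qed.

Lemma ReZ (a : R) z : complex.Re (a%:C * z) = a * complex.Re z.
Proof. by case: z => [? ?] /=; rewrite mul0r subr0. Qed.

Lemma subharmonic_at_add G H z0 : subharmonic_at G z0 -> subharmonic_at H z0 ->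
  subharmonic_at (fun z => G z + H z) z0.
Proof.
move=> [g [r r0 [g0 dg gP]]] [h [s s0 [h0 dh hP]]].
exists (fun z => g z + h z), (Num.min r s); first by rewrite lt_min r0.
split; first by rewrite g0 h0 addr0.
- by move=> z; rewrite lt_min => /andP[/dg ? /dh ?]; exact: cdiffD.
- by move=> z; rewrite lt_min => /andP[/gP ? /hP ?]; rewrite ReD; lra.
Qed.

Lemma subharmonic_at_cst c z0 : subharmonic_at (fun=> c) z0.
Proof.
exists (fun=> 0), 1 => //; split => // z _; first exact: cdiff_cst.
by rewrite addr0.
Qed.

Lemma subharmonic_at_scale (a : R) H z0 : 0 <= a -> subharmonic_at H z0 ->
  subharmonic_at (fun z => a * H z) z0.
Proof.
move=> a0 [h [s s0 [h0 dh hP]]]; exists (fun z => a%:C * h z), s => //; split.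
- by rewrite h0 mulr0.
- by move=> z /dh; exact: cdiffMc.
- by move=> z /hP; rewrite ReZ -mulrDr => ?; exact: ler_wpM2l.
Qed.

Lemma subharmonic_at_sum (I : Type) (s : seq I) (F : I -> R[i] -> R) z0 :
  (forall i, subharmonic_at (F i) z0) -> subharmonic_at (fun z => \sum_(i <- s) F i z) z0.
Proof.
move=> FP; elim: s => [|i s IH].
  by under eq_fun do rewrite big_nil; exact: subharmonic_at_cst.
by under eq_fun do rewrite big_cons; exact: subharmonic_at_add.
Qed.

Lemma subharmonic_at_comp H f z0 (r : R) : 0 < r ->
  (forall z, normc (z - z0) < r -> cdiff f z) ->
  subharmonic_at H (f z0) -> subharmonic_at (H \o f) z0.
Proof.
move=> r0 df [h [s s0 [h0 dh hP]]].
have df0 : cdiff f z0 by apply: df; rewrite subrr ComplexField.Normc.normc0.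
have [d d0 dP] := cdiff_continuous df0 s0.
exists (h \o f), (Num.min r d); first by rewrite lt_min r0.
split => //.
- by move=> z; rewrite lt_min => /andP[/df ? /dP/dh ?]; exact: cdiff_comp.
- by move=> z; rewrite lt_min => /andP[_ /dP/hP].
Qed.

(** The perturbation [K] of H by d |z|^2 is strictly subharmonic: at an interior maximum of [K], a
    support of H would produce an analytic function whose real part has a strict quadratic maximum.
    Comparing a boundary maximum of [K] with its value at 0 costs d r^2. *)
Lemma maximum_principle H r (d : R) : 0 <= r -> 0 < d ->
  (forall z, normc z <= r -> cctn H z) ->
  (forall z, normc z < r -> subharmonic_at H z) ->
  exists2 z, normc z = r & H 0 <= H z + d * r ^+ 2.
Proof.
move=> r0 d0 cH sH.
pose K z := H z + d * normc z ^+ 2.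
have cK z : normc z <= r -> cctn K z.
  move=> zr e e0; have e2 : 0 < e / 2 by rewrite divr_gt0.
  have [d1 d10 d1P] := cH z zr _ e2.
  pose M : R := d * (2 * r + 1).
  have M0 : 0 < M by rewrite mulr_gt0// ltr_wpDl// mulr_ge0.
  exists (Num.min 1 (Num.min d1 (e / 2 / M))).
    by rewrite !lt_min ltr01 d10 !divr_gt0.
  move=> w; rewrite !lt_min => /and3P[w1 /d1P A].
  rewrite ltr_pdivlMr// => B.
  have -> : K w - K z = (H w - H z) + d * (normc w - normc z) * (normc w + normc z).
    by rewrite /K; ring.
  rewrite (splitr e) (le_lt_trans (ler_normD _ _))// ltrD//.
  apply: le_lt_trans B; rewrite !normrM (gtr0_norm d0) /M mulrCA mulrA.
  have wz : `|normc w - normc z| <= normc (w - z).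
    have := normcD (w - z) z; have := normcD (z - w) w; rewrite !subrK (normcBC z).
    by rewrite ler_norml; lra.
  apply: ler_pM => //; first by rewrite mulr_ge0// ltW.
    by rewrite ler_pM2l.
  rewrite ger0_norm ?addr_ge0 ?normc_ge0//.
  by move: wz; rewrite ler_norml; lra.
have [z0 z0r z0max] := cctn_EVT r0 cK.
have [z0E|z0r'] := eqVneq (normc z0) r.
  exists z0 => //; have := z0max 0; rewrite /K ComplexField.Normc.normc0 z0E.
  by rewrite expr0n mulr0 addr0; exact.
exfalso; have {z0r'} z0lt : normc z0 < r by rewrite lt_neqAle z0r'.
have [g [s s0 [g0 dg gP]]] := sH _ z0lt.
(* The first-order part of d |z|^2 at z0 is the real part of c (z - z0); adding it to the support
   leaves exactly -d |z - z0|^2 as upper bound. *)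
pose c := (2 * d)%:C * z0^*.
pose g' z := g z + c * (z - z0).
pose s' := Num.min s (r - normc z0).
apply: (@no_strict_local_max _ g' z0 s' d) => //.
- by rewrite lt_min s0 subr_gt0.
- move=> z; rewrite lt_min => /andP[/dg ? _]; apply: cdiffD => //.
  apply: cdiffMc; apply: cdiffD; [exact: cdiff_id|exact: cdiff_cst].
- by rewrite /g' g0 subrr mulr0 addr0.
- move=> z; rewrite lt_min => /andP[/gP A B].
  have zr : normc z <= r by have := normcD (z - z0) z0; rewrite subrK; lra.
  have := z0max _ zr; rewrite /K /g' ReD.
  have E : normc z ^+ 2 = normc z0 ^+ 2 + normc (z - z0) ^+ 2 + 2 * complex.Re (z0^* * (z - z0)).
    rewrite !normc_sqrE; case: z {A B zr} => a b; case: (z0) => a' b' /=; ring.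
  have -> : complex.Re (c * (z - z0)) = 2 * d * complex.Re (z0^* * (z - z0)).
    by rewrite /c -mulrA ReZ.
  rewrite E; lra.
Qed.

End MaximumPrinciple.

(** * Sums over rotations by roots of unity *)

Section RootsOfUnity.
Variable R : realType.
Implicit Types (z w h : R[i]) (f g : R[i] -> R[i]) (G H : R[i] -> R).
Local Notation normc := (@ComplexField.Normc.normc R).

Definition zroot (N : nat) : R[i] := cexp (0 +i* (pi *+ 2 / N%:R)).

Lemma cexp_exp (t : R) k : cexp (0 +i* t) ^+ k = cexp (0 +i* (k%:R * t)).
Proof.
elim: k => [|k IH]; first by rewrite mul0r expr0 -[LHS]cexp0.
rewrite exprS IH -cexpD; congr cexp; apply/eqP.
by rewrite eq_complex /= addr0 eqxx -natr1 mulrDl mul1r addrC eqxx.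
Qed.

Lemma rot_expn N : (0 < N)%N -> zroot N ^+ N = 1.
Proof.
move=> N0; rewrite cexp_exp mulrCA divff ?pnatr_eq0 -?lt0n// mulr1.
by rewrite /cexp/= expR0 cos2pi sin2pi mulr0 mulr1.
Qed.

Lemma normc_rot_expn N k z : normc (zroot N ^+ k * z) = normc z.
Proof.
by rewrite ComplexField.Normc.normcM cexp_exp normc_cexp/= expR0 mul1r.
Qed.

Definition rot_sum N G z := \sum_(k < N) G (zroot N ^+ k * z).

Lemma rot_sum_rot N G z k : (0 < N)%N -> rot_sum N G (zroot N ^+ k * z) = rot_sum N G z.
Proof.
move=> N0; elim: k => [|k IH]; first by rewrite expr0 mul1r.
rewrite -IH exprS -mulrA; set w := zroot N ^+ k * z; rewrite /rot_sum.
case: N N0 {IH} @w => // N _ w; rewrite big_ord_recr big_ord_recl/= addrC.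
rewrite mulrA -exprSr rot_expn// !mul1r; congr (_ + _).
by apply: eq_bigr => i _; rewrite mulrA -exprSr.
Qed.

Lemma polar z : exists2 t : R, 0 <= t & z = (normc z)%:C * cexp (0 +i* t).
Proof.
have [->|z0] := eqVneq z 0; first by exists 0; rewrite // ComplexField.Normc.normc0 mul0r.
have n0 := normc_gt0 z0; case: z z0 n0 => x y z0; set n := normc _ => n0.
have xn : -1 <= x / n <= 1.
  rewrite -ler_norml normrM normfV (gtr0_norm n0) ler_pdivrMr// mul1r.
  exact: (Re_le_normc (x +i* y)).
have xE : cos (acos (x / n)) = x / n by rewrite acosK// in_itv.
have n2 : n ^+ 2 = x ^+ 2 + y ^+ 2 by rewrite /n normc_sqrE.
have yE : sin (acos (x / n)) = `|y| / n.
  rewrite sin_acos// -[RHS]ger0_norm ?divr_ge0// 1?ltW// -sqrtr_sqr; congr Num.sqrt.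
  rewrite !expr_div_n real_normK ?num_real// n2.
  have d0 : x ^+ 2 + y ^+ 2 != 0 by rewrite -n2 expf_neq0// gt_eqF.
  by field.
have a0 := acos_ge0 xn; have api := acos_lepi xn.
have E t : cos t = x / n -> sin t = y / n -> x +i* y = n%:C * cexp (0 +i* t).
  move=> ct st; apply/eqP; rewrite eq_complex /= expR0 ct st !mul1r !mul0r.
  by rewrite subr0 addr0 !(mulrC n) !divfK ?eqxx ?(gt_eqF n0).
have [y0|y0] := leP 0 y.
  by exists (acos (x / n)) => //; apply: E => //; rewrite yE ger0_norm.
exists (pi *+ 2 - acos (x / n)).
  by rewrite subr_ge0 (le_trans api)// mulr2n lerDl pi_ge0.
apply: E; first by rewrite addrC cosD2pi cosN.
by rewrite addrC sinD2pi sinN yE ltr0_norm// mulNr opprK.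
Qed.

Lemma rot_dense (r e : R) : 0 <= r -> 0 < e -> exists N0 : nat, forall N, (N0 < N)%N ->
  forall z w, normc z = normc w -> normc z <= r ->
  exists k, normc (zroot N ^+ k * w - z) < e.
Proof.
move=> r0 e0.
have [d d0 dP] := @cexp_lin R 1 ltr01.
pose m := Num.min d (e / (r + 1) / 2).
have m0 : 0 < m by rewrite lt_min d0 !divr_gt0// ltr_wpDl.
have [md me] : m <= d /\ m <= e / (r + 1) / 2 by rewrite !ge_min !lexx orbT.
exists (Num.bound (pi *+ 2 / m)) => N NN z w zw zr.
have tp0 : 0 < pi *+ 2 :> R by rewrite mulrn_wgt0// pi_gt0.
have N0 : (0 < N)%N by exact: leq_trans NN.
have NR : 0 < N%:R :> R by rewrite ltr0n.
pose a : R := pi *+ 2 / N%:R.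
have a0 : 0 < a by rewrite divr_gt0.
have am : a < m.
  rewrite ltr_pdivrMr// mulrC -ltr_pdivrMr//.
  apply: (lt_trans (archi_boundP _)); first by rewrite divr_ge0// ltW.
  by rewrite ltr_nat.
have [t t0 tE] := polar z; have [s s0 sE] := polar w.
(* Full turns are added to make the angle from w to z nonnegative, so that a natural number of steps
   suffices. *)
pose q := t + pi *+ 2 * (Num.bound (s / (pi *+ 2)))%:R - s.
have q0 : 0 <= q.
  have := archi_boundP (divr_ge0 s0 (ltW tp0)).
  by rewrite ltr_pdivrMr// mulrC /q => /ltW; lra.
have cq : cexp (0 +i* (s + q)) = cexp (0 +i* t).
  rewrite /q addrC subrK; set j := Num.bound _.
  have -> : 0 +i* (t + pi *+ 2 * j%:R) = 0 +i* t + 0 +i* (j%:R * (pi *+ 2)) :> R[i].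
    by apply/eqP; rewrite eq_complex /= addr0 mulrC !eqxx.
  rewrite cexpD -cexp_exp.
  have -> : cexp (0 +i* (pi *+ 2)) = 1 :> R[i].
    by rewrite /cexp/= expR0 cos2pi sin2pi mulr0 mulr1.
  by rewrite expr1n mulr1.
have /andP[k1 k2] := Num.Theory.truncn_itv (divr_ge0 q0 (ltW a0)).
set k := Num.truncn _ in k1 k2.
exists k.
pose b := q - k%:R * a.
have b0 : 0 <= b by rewrite subr_ge0 -ler_pdivlMr.
have ba : b < a by move: k2; rewrite ltr_pdivrMr// -natr1 mulrDl mul1r /b; lra.
have -> : zroot N ^+ k * w - z = zroot N ^+ k * w * (1 - cexp (0 +i* b)).
  rewrite mulrBr mulr1; congr (_ - _).
  rewrite {1}tE -cq zw {2}sE cexp_exp -/a -!mulrA [RHS]mulrCA -!cexpD.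
  congr (_ * cexp _); apply/eqP; rewrite eq_complex /= !addr0 eqxx/=.
  by apply/eqP; rewrite /b; ring.
rewrite ComplexField.Normc.normcM normc_rot_expn.
have nb : normc (0 +i* b) = b.
  by rewrite /ComplexField.Normc.normc expr0n add0r sqrtr_sqr ger0_norm.
have := dP (0 +i* b); rewrite nb mul1r => /(_ (lt_le_trans (lt_trans ba am) md)) A.
have B : normc (1 - cexp (0 +i* b)) <= b + b.
  rewrite normcBC.
  have -> : cexp (0 +i* b) - 1 = (cexp (0 +i* b) - 1 - 0 +i* b) + 0 +i* b by ring.
  by apply: (le_trans (normcD _ _)); rewrite nb lerD2r.
have C : b + b < e / (r + 1) by have := lt_trans ba am; lra.
rewrite -zw; apply: (@le_lt_trans _ _ (r * (b + b))).
  by apply: ler_pM => //; exact: normc_ge0.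
apply: (@le_lt_trans _ _ ((r + 1) * (b + b))).
  by apply: ler_wpM2r; [rewrite addr_ge0|rewrite lerDl ler01].
by rewrite mulrC -ltr_pdivlMr// ltr_wpDl.
Qed.

(** An approximate sub-mean value property. The maximum principle on the disc of radius |z| bounds
    the sum from below at some z1 on its boundary circle. The sum is invariant under rotation, so z1
    may be moved close to z, and uniform continuity controls each term; the two steps cost e / 2 per
    term. *)
Lemma rot_sum_ge H (r e : R) : 0 <= r -> 0 < e ->
  (forall z, normc z <= r -> cctn H z) ->
  (forall z, normc z < r -> subharmonic_at H z) ->
  exists N0 : nat, forall N, (N0 < N)%N -> forall z, normc z <= r ->
    N%:R * (H 0 - e) <= rot_sum N H z.
Proof.
move=> r0 e0 cH sH.
have e2 : 0 < e / 2 by rewrite divr_gt0.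
have [d d0 dP] := cctn_uniform cH e2.
have [N0 N0P] := rot_dense r0 d0; exists N0 => N NN z zr.
have NR : 0 < N%:R :> R by rewrite ltr0n (leq_trans _ NN).
pose s := normc z; have s0 : 0 <= s by exact: normc_ge0.
(* The perturbation constant: multiplied by s^2 it stays below N e / 2. The added 1 covers s = 0. *)
have c0 : 0 < N%:R * (e / 2) / (s ^+ 2 + 1).
  by rewrite divr_gt0 ?mulr_gt0// ltr_wpDl// sqr_ge0.
have crot z' N' k : normc z' <= s -> cctn (fun z => H (zroot N' ^+ k * z)) z'.
  move=> z's e' /(cH (zroot N' ^+ k * z')); rewrite normc_rot_expn (le_trans z's)//.
  move=> /(_ isT)[d' d'0 d'P]; exists d' => // w wd.
  by apply: d'P; rewrite -mulrBr normc_rot_expn.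
have [z1 z1s zmax] : exists2 z1, normc z1 = s &
    rot_sum N H 0 <= rot_sum N H z1 + N%:R * (e / 2) / (s ^+ 2 + 1) * s ^+ 2.
  apply: maximum_principle => // z' z's.
    by apply: cctn_sum => k; exact: crot.
  apply: subharmonic_at_sum => k.
  apply: (@subharmonic_at_comp _ H (fun z => zroot N ^+ k * z) z' 1) => //.
    by move=> w _; apply: cdiffMc; exact: cdiff_id.
  by apply: sH; rewrite normc_rot_expn (lt_le_trans z's).
have [k kd] := N0P N NN _ _ (esym z1s) zr.
have : `|rot_sum N H (zroot N ^+ k * z1) - rot_sum N H z| <= N%:R * (e / 2).
  rewrite -sumrB; apply: (le_trans (ler_norm_sum _ _ _)).
  have -> : N%:R * (e / 2) = \sum_(i < N) (e / 2) by rewrite sumr_const card_ord mulr_natl.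
  apply: ler_sum => i _; apply: ltW; apply: dP; rewrite ?normc_rot_expn ?z1s//.
  by rewrite -mulrBr normc_rot_expn.
rewrite rot_sum_rot; last exact: leq_trans NN.
have H0 : rot_sum N H 0 = N%:R * H 0.
  rewrite /rot_sum; under eq_bigr do rewrite mulr0.
  by rewrite sumr_const card_ord mulr_natl.
have : N%:R * (e / 2) / (s ^+ 2 + 1) * s ^+ 2 <= N%:R * (e / 2).
  rewrite -mulrA ger_pMr ?mulr_gt0// mulrC ler_pdivrMr ?ltr_wpDl ?sqr_ge0//.
  by rewrite mul1r lerDl.
move: zmax; rewrite H0 ler_norml mulrBr => zmax b1 /andP[_ b2].
have -> : N%:R * e = N%:R * (e / 2) + N%:R * (e / 2) by field.
lra.
Qed.

End RootsOfUnity.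

(** * Tangent estimates for real powers *)

Section Tangents.
Variable R : realType.

Lemma powR_le (p x y : R) : 0 <= p -> 0 <= x -> x <= y -> x `^ p <= y `^ p.
Proof.
move=> p0 x0 xy; apply: ge0_ler_powR; rewrite ?nnegrE//; exact: le_trans xy.
Qed.

(** Young's inequality for the factors (1 + s)^q and 1, with exponents 1 / q and 1 / (1 - q). *)
Lemma bernoulli_le (q s : R) : 0 < q <= 1 -> 0 <= 1 + s -> (1 + s) `^ q <= 1 + q * s.
Proof.
move=> /andP[q0]; rewrite le_eqVlt => /predU1P[->|q1] s0; first by rewrite powRr1// mul1r.
have q0' : 0 <= q by exact: ltW.
have := @conjugate_powR _ ((1 + s) `^ q) 1 q^-1 (1 - q)^-1 (powR_ge0 _ _) ler01.
rewrite -powRrM mulfV ?gt_eqF// powRr1// powR1 mulr1 !invrK.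
rewrite !invr_gt0 subr_gt0 subrKC => /(_ q0 q1 erefl); lra.
Qed.

(** Where 1 + q s is nonnegative, this is [bernoulli_le] with exponent 1 / q, raised to the power
    q. *)
Lemma bernoulli_ge (q s : R) : 1 <= q -> 0 <= 1 + s -> 1 + q * s <= (1 + s) `^ q.
Proof.
move=> q1 s0; have q0 : 0 < q by exact: lt_le_trans q1.
have [t0|/ltW t0] := leP 0 (1 + q * s); last exact: le_trans t0 (powR_ge0 _ _).
have := @bernoulli_le q^-1 (q * s).
rewrite invr_gt0 q0 invf_le1// q1 mulrA mulVf ?gt_eqF// mul1r => /(_ isT t0) A.
have -> : 1 + q * s = ((1 + q * s) `^ q^-1) `^ q.
  by rewrite -powRrM mulVf ?gt_eqF// powRr1.
by apply: ge0_ler_powR => //; rewrite ?nnegrE ?powR_ge0// ltW.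
Qed.

(* Compare with (1 + s)^2 = (1 + s)^(1 + r) (1 + s)^(1 - r). *)
Lemma bernoulli_sqr (r s : R) : 0 < r <= 1 -> `|s| <= 1 ->
  1 + (1 + r) * s + r ^+ 2 / 2 * s ^+ 2 <= (1 + s) `^ (1 + r).
Proof.
move=> /andP[r0 r1]; rewrite ler_norml => /andP[s1 s2].
have s0 : 0 <= 1 + s by lra.
have [sE|sE] := eqVneq (1 + s) 0.
  have -> : s = - 1 by lra.
  apply: le_trans (powR_ge0 _ _).
  have : r * r <= r * 1 by rewrite ler_wpM2l// ltW.
  by rewrite sqrrN expr1n expr2; lra.
have sp : 0 < 1 + s by rewrite lt_neqAle eq_sym sE.
have D : (1 + s) `^ (1 - r) <= 1 + (1 - r) * s.
  have [->|r1'] := eqVneq r 1; first by rewrite subrr powRr0 mul0r addr0.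
  by apply: bernoulli_le => //; rewrite subr_gt0 lt_neqAle r1' r1/=; lra.
have D0 : 0 < 1 + (1 - r) * s by apply: lt_le_trans D; rewrite powR_gt0.
rewrite -(ler_pM2r D0).
apply: (@le_trans _ _ ((1 + s) ^+ 2)).
  (* After multiplication by 1 + (1 - r) s the defect factors exactly in this form. *)
  have : 0 <= s ^+ 2 * r ^+ 2 * (1 - (1 + (1 - r) * s) / 2).
    have rs : (1 - r) * s <= (1 - r) * 1 by apply: ler_wpM2l; lra.
    apply: mulr_ge0; first by rewrite mulr_ge0 ?sqr_ge0.
    lra.
  have -> : s ^+ 2 * r ^+ 2 * (1 - (1 + (1 - r) * s) / 2) = (1 + s) ^+ 2 -
    (1 + (1 + r) * s + r ^+ 2 / 2 * s ^+ 2) * (1 + (1 - r) * s) by field.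
  by rewrite subr_ge0.
have -> : (1 + s) ^+ 2 = (1 + s) `^ (1 + r) * (1 + s) `^ (1 - r).
  rewrite -powRD; last by rewrite sE implybT.
  have -> : 1 + r + (1 - r) = 2%:R by ring.
  by rewrite powR_mulrn.
by rewrite ler_wpM2l// powR_ge0.
Qed.

Lemma powR_scale (q y0 y : R) : 0 < y0 -> 0 <= y -> y `^ q = y0 `^ q * (1 + (y - y0) / y0) `^ q.
Proof.
move=> y00 y1.
have -> : 1 + (y - y0) / y0 = y / y0 by field; rewrite gt_eqF.
by rewrite -powRM ?divr_ge0// ?ltW// mulrC divfK// gt_eqF.
Qed.

Lemma powR_pred (q y0 : R) : 0 < y0 -> y0 `^ q = y0 `^ (q - 1) * y0.
Proof.
move=> y00; have y0n : y0 != 0 by rewrite gt_eqF.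
rewrite powRB; last by rewrite y0n implybT.
by rewrite powRr1 ?(ltW y00)// divfK.
Qed.

Lemma scaled_ge0 (y0 y : R) : 0 < y0 -> 0 <= y -> 0 <= 1 + (y - y0) / y0.
Proof.
move=> y00 y1; have -> : 1 + (y - y0) / y0 = y / y0 by field; rewrite gt_eqF.
by rewrite divr_ge0// ltW.
Qed.

Lemma powR_tangent_le (q y0 y : R) : 0 < q <= 1 -> 0 < y0 -> 0 <= y ->
  y `^ q <= y0 `^ q + q * y0 `^ (q - 1) * (y - y0).
Proof.
move=> q01 y00 y1; rewrite (powR_scale _ y00 y1).
apply: (le_trans (ler_wpM2l (powR_ge0 _ _) (bernoulli_le q01 (scaled_ge0 y00 y1)))).
rewrite (powR_pred _ y00) le_eqVlt; apply/orP; left; apply/eqP; field.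
by rewrite gt_eqF.
Qed.

Lemma powR_tangent_ge (q y0 y : R) : 1 <= q -> 0 < y0 -> 0 <= y ->
  y0 `^ q + q * y0 `^ (q - 1) * (y - y0) <= y `^ q.
Proof.
move=> q1 y00 y1; rewrite (powR_scale _ y00 y1).
apply: le_trans (ler_wpM2l (powR_ge0 _ _) (bernoulli_ge q1 (scaled_ge0 y00 y1))).
rewrite (powR_pred _ y00) le_eqVlt; apply/orP; left; apply/eqP; field.
by rewrite gt_eqF.
Qed.

(** [bernoulli_sqr] rescaled to the base point y0. The quadratic gain is what pays for the curvature
    of |z|^p in [potential_base]. *)
Lemma powR_tangent_sqr (p y0 y : R) : 1 < p <= 2 -> 0 < y0 -> `|y - y0| <= y0 ->
  y0 `^ p + p * y0 `^ (p - 1) * (y - y0) +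
    (p - 1) ^+ 2 / 2 * y0 `^ (p - 2) * (y - y0) ^+ 2 <= y `^ p.
Proof.
move=> p12 y00 yy; have y1 : 0 <= y by move: yy; rewrite ler_norml; lra.
rewrite (powR_scale _ y00 y1).
have r01 : 0 < p - 1 <= 1 by lra.
have := bernoulli_sqr (s := (y - y0) / y0) r01.
rewrite normrM normfV (gtr0_norm y00) ler_pdivrMr// mul1r => /(_ yy) B.
rewrite subrKC in B.
apply: le_trans (ler_wpM2l (powR_ge0 _ _) B).
rewrite (powR_pred p y00) (powR_pred (p - 1) y00).
have -> : p - 1 - 1 = p - 2 by ring.
rewrite le_eqVlt; apply/orP; left; apply/eqP; field.
by rewrite gt_eqF.
Qed.

Lemma powR_continuous (p y : R) : 0 < y -> {for y, continuous (fun x : R => x `^ p)}.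
Proof.
move=> y0; apply: differentiable_continuous; apply/derivable1_diffP.
by apply: derivable_powR; rewrite in_itv/= y0.
Qed.

End Tangents.

(** * Subharmonic minorants of C |Re z|^p - |z|^p *)

Section Potentials.
Variable R : realType.
Implicit Types (z w h : R[i]) (f g : R[i] -> R[i]) (G H : R[i] -> R).
Local Notation normc := (@ComplexField.Normc.normc R).

Lemma cctn_comp (phi : R -> R) G z : {for G z, continuous phi} -> cctn G z ->
  cctn (phi \o G) z.
Proof.
move=> cphi cG e e0.
have /cvgrPdist_lt/(_ e e0)/nbhs_ballP[d /= d0 dP] := cphi.
have [d' d'0 d'P] := cG d d0; exists d' => // w /d'P A.
by rewrite distrC; apply: dP; rewrite /ball/= distrC.
Qed.

Lemma cctn_compr H f z : cdiff f z -> cctn H (f z) -> cctn (H \o f) z.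
Proof.
move=> df cH e /cH[d d0 dP]; have [d' d'0 d'P] := cdiff_continuous df d0.
by exists d' => // w /d'P/dP.
Qed.

Lemma cctn_scale (a : R) H z : cctn H z -> cctn (fun z => a * H z) z.
Proof.
move=> cH; apply: (cctn_comp (phi := *%R a)) => //.
by apply: cvgMr; exact: cvg_id.
Qed.

Lemma cctn_normc z : cctn normc z.
Proof.
move=> e e0; exists e => // w /le_lt_trans; apply.
have := normcD (w - z) z; have := normcD (z - w) w; rewrite !subrK (normcBC z).
by rewrite ler_norml; lra.
Qed.

Lemma cctn_absRe z : cctn (fun z => `|complex.Re z|) z.
Proof.
move=> e e0; exists e => // w /le_lt_trans; apply.
apply: le_trans (Re_le_normc _); rewrite ReD.
have -> : complex.Re (- z) = - complex.Re z by case: (z).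
exact: ler_dist_dist.
Qed.

Lemma cctn_absRe_powR (d p : R) z : 0 < d ->
  cctn (fun z => (`|complex.Re z| + d) `^ p) z.
Proof.
move=> d0; apply: (cctn_comp (phi := fun x => x `^ p)).
  by apply: powR_continuous; rewrite ltr_wpDl.
by apply: cctn_add; [exact: cctn_absRe|exact: cctn_cst].
Qed.

(** The sign is frozen at the base point: s Re w is then linear in w, lies below |Re w| by [sgn_le],
    and touches it at z. *)
Lemma sgn_ReE z : exists2 s : R, s ^+ 2 = 1 & `|complex.Re z| = s * complex.Re z.
Proof.
have [x0|x0] := leP 0 (complex.Re z).
  by exists 1; rewrite ?expr1n// mul1r ger0_norm.
by exists (-1); rewrite ?sqrrN ?expr1n// mulN1r ltr0_norm.
Qed.

Lemma sgn_le (s : R) z : s ^+ 2 = 1 -> s * complex.Re z <= `|complex.Re z|.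
Proof.
move=> s2; apply: (le_trans (ler_norm _)); rewrite normrM.
suff -> : `|s| = 1 by rewrite mul1r.
by apply/eqP; rewrite -sqrp_eq1// -normrX s2 normr1.
Qed.

Lemma absRe_powR_subharmonic (d p : R) z : 0 < d -> 1 <= p ->
  subharmonic_at (fun z => (`|complex.Re z| + d) `^ p) z.
Proof.
move=> d0 p1; have [s s2 sE] := sgn_ReE z.
pose y0 := `|complex.Re z| + d; have y00 : 0 < y0 by rewrite ltr_wpDl.
pose c := p * y0 `^ (p - 1) * s.
(* Within distance d of z the argument s Re w + d of the power stays nonnegative. *)
exists (fun w => c%:C * (w - z)), d => //; split.
- by rewrite subrr mulr0.
- move=> w _; apply: cdiffMc.
  by apply: cdiffD; [exact: cdiff_id|exact: cdiff_cst].
- move=> w wd; rewrite ReZ -/y0.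
  have A : s * complex.Re w - s * complex.Re z <= `|complex.Re (w - z)|.
    rewrite -mulrBr; have -> : complex.Re w - complex.Re z = complex.Re (w - z).
      by case: (w) (z) => [? ?] [? ?].
    exact: sgn_le.
  have A' : - `|complex.Re (w - z)| <= s * complex.Re w - s * complex.Re z.
    rewrite -mulrBr; have -> : complex.Re w - complex.Re z = complex.Re (w - z).
      by case: (w) (z) => [? ?] [? ?].
    by have := @sgn_le (- s) (w - z); rewrite sqrrN s2 mulNr => /(_ erefl); lra.
  have B := Re_le_normc (w - z).
  have y1 : 0 <= s * complex.Re w + d.
    by have : 0 <= s * complex.Re z by [rewrite -sE]; lra.
  have D : (s * complex.Re w + d) `^ p <= (`|complex.Re w| + d) `^ p.
    apply: powR_le => //; first lra.
    by rewrite lerD2r; exact: sgn_le.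
  apply: le_trans D; apply: le_trans (powR_tangent_ge p1 y00 y1).
  have -> : s * complex.Re w + d - y0 = s * complex.Re (w - z).
    by rewrite /y0 sE; case: (w) (z) => [? ?] [? ?] /=; ring.
  by rewrite lerD2l /c mulrA.
Qed.

(** C is fixed before d, which is later chosen small. The global lower bound is there for the
    doubling step: the map -i z^2 sends the real axis into the imaginary axis, about which the last
    clause says nothing. *)
Definition has_potential (p : R) := exists2 C : R, 0 <= C & forall d : R, 0 < d ->
  exists Phi : R[i] -> R, [/\ forall z, cctn Phi z, forall z, subharmonic_at Phi z,
    forall z, Phi z <= C * (`|complex.Re z| + d) `^ p - normc z `^ p,
    forall z, - C * (normc z + d) `^ p <= Phi z &
    forall a : R, 0 <= Phi a%:C].

Lemma sqr_powR_half (x p : R) : 0 <= x -> (x ^+ 2) `^ (p / 2) = x `^ p.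
Proof. by move=> x0; rewrite -powR_mulrn// -powRrM mulrC divfK. Qed.

(** |z|^p is smoothed to Q^(p/2). As a function of Q this is concave, so it lies below its tangent,
    while (|Re z| + d)^p exceeds its tangent by a quadratic term; the latter has to win. *)
Lemma potential_base (p : R) : 1 < p <= 2 -> has_potential p.
Proof.
move=> /andP[p1 p2].
have r0 : 0 < p - 1 by lra.
have q01 : 0 < p / 2 <= 1 by lra.
(* Turns the quadratic coefficient (p - 1)^2 / 2 into 4. Moreover C >= 8 leaves room for the bound
   Q^(p/2) <= 2 (|z| + d)^p in the last two clauses. *)
pose C : R := 8 / (p - 1) ^+ 2.
have C8 : 8 <= C.
  rewrite /C ler_pdivlMr ?exprn_gt0// ger_pMr//.
  by rewrite exprn_ile1//; lra.
have C0 : 0 <= C by lra.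
exists C => // d d0.
(* The factors 2 give (|Re z| + d)^2 <= Q z, hence Q^(p/2 - 1) <= (|Re z| + d)^(p - 2), the
   exponents being nonpositive. *)
pose Q z := 2 * normc z ^+ 2 + 2 * d ^+ 2.
have dd : 0 < d ^+ 2 by rewrite exprn_gt0.
have Q0 z : 0 < Q z by rewrite ltr_wpDl ?mulr_gt0// mulr_ge0// sqr_ge0.
have Qup z : (Q z) `^ (p / 2) <= 2 * (normc z + d) `^ p.
  have nd : 0 <= normc z + d by rewrite addr_ge0 ?normc_ge0// ltW.
  rewrite -(sqr_powR_half p nd).
  apply: (@le_trans _ _ ((2 * (normc z + d) ^+ 2) `^ (p / 2))).
    apply: powR_le; [lra|exact: ltW|].
    have : 0 <= normc z * d by rewrite mulr_ge0 ?normc_ge0// ltW.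
    by rewrite /Q sqrrD; lra.
  rewrite powRM ?sqr_ge0// ler_wpM2r ?powR_ge0//.
  by apply: ler1_powR; [rewrite ler1n|lra].
exists (fun z => C * (`|complex.Re z| + d) `^ p + (-1) * (Q z) `^ (p / 2)); split.
- move=> z; apply: cctn_add; first by apply: cctn_scale; exact: cctn_absRe_powR.
  apply: cctn_scale; apply: (cctn_comp (phi := fun x => x `^ (p / 2))).
    exact: powR_continuous.
  apply: cctn_add; last exact: cctn_cst.
  apply: cctn_scale; apply: (cctn_comp (phi := fun x => x ^+ 2)).
    exact: exprn_continuous.
  exact: cctn_normc.
- move=> z; have [s s2 sE] := sgn_ReE z.
  pose y0 := `|complex.Re z| + d; have y00 : 0 < y0 by rewrite ltr_wpDl.
  pose B := 2 * (p / 2) * (Q z) `^ (p / 2 - 1).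
  have By : B <= 2 * y0 `^ (p - 2).
    have BQ : (Q z) `^ (p / 2 - 1) <= y0 `^ (p - 2).
      have -> : p - 2 = 2%:R * (p / 2 - 1) by field.
      rewrite powRrM powR_mulrn ?(ltW y00)//.
      have yQ : y0 ^+ 2 <= Q z.
        have : `|complex.Re z| ^+ 2 <= normc z ^+ 2.
          by rewrite ler_sqr ?nnegrE ?normc_ge0// Re_le_normc.
        have := sqr_ge0 (`|complex.Re z| - d).
        by rewrite /y0 /Q sqrrB sqrrD; lra.
      have -> : p / 2 - 1 = - (1 - p / 2) by ring.
      rewrite !powRN. rewrite lef_pV2 ?posrE ?powR_gt0 ?exprn_gt0//.
      by apply: powR_le; rewrite ?sqr_ge0//; lra.
    rewrite /B; have := powR_ge0 (Q z) (p / 2 - 1); nra.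
  (* [c] collects the first-order terms at z of the two tangent estimates. *)
  pose c : R[i] := (C * p * y0 `^ (p - 1) * s)%:C - (2 * B)%:C * z^*.
  exists (fun w => c * (w - z) + (2 * y0 `^ (p - 2))%:C * (w - z) ^+ 2), d => //.
  have dwz w : cdiff (fun w => w - z) w.
    by apply: cdiffD; [exact: cdiff_id|exact: cdiff_cst].
  split.
  + by rewrite subrr expr0n !mulr0 addr0.
  + move=> w _; apply: cdiffD; first exact: cdiffMc.
    by apply: cdiffMc; exact: cdiff_sqr.
  + move=> w wd; pose y := s * complex.Re w + d.
    have yE : y - y0 = s * complex.Re (w - z).
      by rewrite /y /y0 sE; case: (w) (z) => [? ?] [? ?] /=; ring.
    have yy : `|y - y0| <= y0.
      rewrite yE ler_norml; apply/andP.
      have A := Re_le_normc (w - z); have A1 := sgn_le (w - z) s2.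
      have A2 : - s * complex.Re (w - z) <= `|complex.Re (w - z)|.
        by apply: sgn_le; rewrite sqrrN.
      have dy : d <= y0 by rewrite lerDr.
      by split; lra.
    have y1 : 0 <= y by move: yy; rewrite ler_norml; lra.
    have p12 : 1 < p <= 2 by rewrite p1.
    have T1 := powR_tangent_sqr p12 y00 yy.
    have D : y `^ p <= (`|complex.Re w| + d) `^ p.
      apply: powR_le => //; first lra.
      by rewrite lerD2r; exact: sgn_le.
    have T2 := powR_tangent_le q01 (Q0 z) (ltW (Q0 w)).
    have T3 : C * (y0 `^ p + p * y0 `^ (p - 1) * (y - y0) +
       (p - 1) ^+ 2 / 2 * y0 `^ (p - 2) * (y - y0) ^+ 2) <=
       C * (`|complex.Re w| + d) `^ p by apply: ler_wpM2l => //; exact: le_trans D.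
    have T4 : C * (y0 `^ p + p * y0 `^ (p - 1) * (y - y0) +
       (p - 1) ^+ 2 / 2 * y0 `^ (p - 2) * (y - y0) ^+ 2) =
       C * y0 `^ p + C * p * y0 `^ (p - 1) * s * complex.Re (w - z) +
       4 * y0 `^ (p - 2) * complex.Re (w - z) ^+ 2.
      rewrite yE exprMn s2 mul1r /C; field; lra.
    have T5 : p / 2 * (Q z) `^ (p / 2 - 1) * (Q w - Q z) =
      B * (normc (w - z) ^+ 2 + 2 * complex.Re (z^* * (w - z))).
      have -> : Q w - Q z = 2 * (normc (w - z) ^+ 2 + 2 * complex.Re (z^* * (w - z))).
        rewrite /Q !normc_sqrE; case: (w) (z) => [? ?] [? ?] /=; ring.
      by rewrite /B; ring.
    have T6 : complex.Re (c * (w - z) + (2 * y0 `^ (p - 2))%:C * (w - z) ^+ 2) =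
      C * p * y0 `^ (p - 1) * s * complex.Re (w - z)
      - 2 * B * complex.Re (z^* * (w - z)) +
      2 * y0 `^ (p - 2) * complex.Re ((w - z) ^+ 2).
      by rewrite /c; move: (w - z) => [? ?]; case: (z) => [? ?]; rewrite expr2 /=; ring.
    (* For h = w - z this splits the gain 4 y0^(p-2) (Re h)^2 into 2 y0^(p-2) |h|^2, which absorbs B
       |h|^2, and the real part of the analytic term 2 y0^(p-2) h^2. *)
    have T7 : 2 * complex.Re (w - z) ^+ 2 = normc (w - z) ^+ 2 + complex.Re ((w - z) ^+ 2).
      by rewrite normc_sqrE; case: (w - z) => [? ?]; rewrite [in RHS]expr2 /=; ring.
    have T8 : B * normc (w - z) ^+ 2 <= 2 * y0 `^ (p - 2) * normc (w - z) ^+ 2.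
      by rewrite ler_wpM2r ?sqr_ge0.
    rewrite T6 -/y0.
    have T9 : 4 * y0 `^ (p - 2) * complex.Re (w - z) ^+ 2 =
      2 * y0 `^ (p - 2) * normc (w - z) ^+ 2 + 2 * y0 `^ (p - 2) * complex.Re ((w - z) ^+ 2).
      by rewrite -mulrDr -T7; ring.
    lra.
- move=> z; have : normc z `^ p <= (Q z) `^ (p / 2).
    rewrite -(sqr_powR_half p (normc_ge0 z)).
    apply: powR_le; rewrite ?sqr_ge0//; first lra.
    by rewrite /Q; have := sqr_ge0 (normc z); lra.
  lra.
- move=> z; have := Qup z; have A := powR_ge0 (`|complex.Re z| + d) p.
  have B := powR_ge0 (normc z + d) p.
  have : 0 <= C * (`|complex.Re z| + d) `^ p by rewrite mulr_ge0.
  have : 2 * (normc z + d) `^ p <= C * (normc z + d) `^ p by rewrite ler_wpM2r//; lra.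
  lra.
- move=> a; have := Qup a%:C; rewrite normc_real /=.
  have : 2 * (`|a| + d) `^ p <= C * (`|a| + d) `^ p by rewrite ler_wpM2r ?powR_ge0//; lra.
  lra.
Qed.

(** The new potential is twice Phi(-i z^2) + C (|Re z| + d)^(2p). The added term compensates the
    lower bound of Phi on the imaginary axis. Half of |z|^(2p) is spent on absorbing |2xy|^p, and
    the factor 2 restores its coefficient. *)
Lemma potential_double (p : R) : 1 < p -> has_potential p -> has_potential (p * 2).
Proof.
move=> p1 [C C0 CP].
have p0 : 0 <= p by lra.
(* Threshold between two regimes. If |z| >= l X, with X = |Re z| + d, then Y <= (3 / l) |z|^2 and C
   (3 / l) <= 1 / 2; otherwise Y <= (2 l + 1) X^2, which produces [K]. Also 3 / l <= 1, so its p-th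
   power does not exceed it. *)
pose l := 6 * C + 3; have l3 : 3 <= l by rewrite /l; lra.
pose K := C * (2 * l + 1) `^ p.
have K0 : 0 <= K by rewrite mulr_ge0 ?powR_ge0.
exists (2 * (K + C)); first by rewrite mulr_ge0 ?addr_ge0.
move=> d d0; have dd : 0 < d ^+ 2 by rewrite exprn_gt0.
have [Phi [cP sP upP loP reP]] := CP _ dd.
have pp : p * 2 / 2 = p by rewrite mulfK.
have sq (x : R) : 0 <= x -> x `^ (p * 2) = (x ^+ 2) `^ p.
  by move=> x0; rewrite -(sqr_powR_half _ x0) pp.
pose sqf z : R[i] := - 'i * z ^+ 2.
have dsq z : cdiff sqf z by apply: cdiffMc; apply: cdiff_sqr; exact: cdiff_id.
have nsq z : normc (sqf z) = normc z ^+ 2.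
  rewrite /sqf expr2 !ComplexField.Normc.normcM normc_opp.
  have -> : normc 'i = 1 by rewrite /ComplexField.Normc.normc expr0n expr1n add0r sqrtr1.
  by rewrite mul1r.
have rsq z : `|complex.Re (sqf z)| = 2 * `|complex.Re z| * `|complex.Im z|.
  rewrite -[2 in RHS]ger0_norm// -!normrM; congr `|_|.
  by rewrite /sqf; case: (z) => [? ?] /=; ring.
exists (fun z => 2 * (Phi (sqf z) + C * (`|complex.Re z| + d) `^ (p * 2))); split.
- move=> z; apply: cctn_scale; apply: cctn_add; first exact: (cctn_compr (dsq z)).
  by apply: cctn_scale; exact: cctn_absRe_powR.
- move=> z; apply: subharmonic_at_scale => //; apply: subharmonic_at_add.
    exact: (subharmonic_at_comp (r := 1)).
  apply: subharmonic_at_scale => //; apply: absRe_powR_subharmonic => //; lra.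
- move=> z; have := upP (sqf z); rewrite nsq rsq -sq ?normc_ge0//.
  set n := normc z; have n0 : 0 <= n by exact: normc_ge0.
  pose X := `|complex.Re z| + d.
  have X0 : 0 < X by rewrite ltr_wpDl.
  rewrite -/X; set Y := 2 * `|complex.Re z| * `|complex.Im z| + d ^+ 2.
  have Y0 : 0 <= Y by apply: addr_ge0; [rewrite !mulr_ge0|exact: sqr_ge0].
  have YX : Y <= 2 * X * n + X ^+ 2.
    apply: lerD.
      apply: ler_pM => //.
        by rewrite ler_pM2l// lerDl ltW.
      exact: Im_le_normc.
    by rewrite ler_sqr ?nnegrE ?(ltW X0) ?(ltW d0)// lerDr.
  have key : C * Y `^ p <= n `^ (p * 2) / 2 + K * X `^ (p * 2).
    have KX : 0 <= K * X `^ (p * 2) by rewrite mulr_ge0 ?powR_ge0.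
    have nn : 0 <= n `^ (p * 2) by exact: powR_ge0.
    have l0 : 0 < l by lra.
    have [nX|Xn] := leP (l * X) n.
      have Yn : Y <= 3 / l * n ^+ 2.
        apply: (le_trans YX).
        have Xl : X <= n / l by rewrite ler_pdivlMr// mulrC.
        have XX : X * n <= n / l * n by rewrite ler_wpM2r.
        have X2 : X ^+ 2 <= n / l * n.
          rewrite expr2; apply: ler_pM => //; try exact: ltW.
          by apply: (le_trans Xl); rewrite ler_pdivrMr// ler_peMr//; lra.
        have -> : 3 / l * n ^+ 2 = 3 * (n / l * n) by ring.
        lra.
      have l31 : 0 < 3 / l <= 1 by rewrite divr_gt0//= ler_pdivrMr// mul1r.
      have : Y `^ p <= 3 / l * n `^ (p * 2).
        apply: (@le_trans _ _ ((3 / l * n ^+ 2) `^ p)).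
          exact: powR_le.
        rewrite sq//; apply: ge1r_powRZ => //; [exact: sqr_ge0|exact: ltW].
      move=> /(ler_wpM2l C0) A; apply: (le_trans A).
      have Cl : C * (3 / l) <= 1 / 2.
        by rewrite mulrA ler_pdivrMr// /l; lra.
      have := ler_wpM2r nn Cl; rewrite mulrA; lra.
    have Yl : Y <= (2 * l + 1) * X ^+ 2.
      apply: (le_trans YX).
      have : X * n <= X * (l * X) by rewrite ler_pM2l// ltW.
      have -> : X * (l * X) = l * X ^+ 2 by ring.
      lra.
    have : Y `^ p <= (2 * l + 1) `^ p * X `^ (p * 2).
      rewrite sq ?(ltW X0)// -powRM ?sqr_ge0//; last lra.
      exact: powR_le.
    move=> /(ler_wpM2l C0); rewrite mulrA -/K; lra.
  lra.
- move=> z; have := loP (sqf z); rewrite nsq sq; last first.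
    by rewrite addr_ge0 ?normc_ge0// ltW.
  have n0 := normc_ge0 z.
  have A : (normc z ^+ 2 + d ^+ 2) `^ p <= ((normc z + d) ^+ 2) `^ p.
    apply: powR_le; rewrite ?addr_ge0 ?sqr_ge0//.
    have : 0 <= normc z * d by rewrite mulr_ge0// ltW.
    by rewrite sqrrD; lra.
  have := ler_wpM2l C0 A.
  have : 0 <= K * ((normc z + d) ^+ 2) `^ p by rewrite mulr_ge0 ?powR_ge0.
  have : 0 <= C * (`|complex.Re z| + d) `^ (p * 2) by rewrite mulr_ge0 ?powR_ge0.
  lra.
- move=> a; have := loP (sqf a%:C); rewrite nsq normc_real /=.
  rewrite sq; last by rewrite addr_ge0// ltW.
  have A : (`|a| ^+ 2 + d ^+ 2) `^ p <= ((`|a| + d) ^+ 2) `^ p.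
    apply: powR_le; rewrite ?addr_ge0 ?sqr_ge0//.
    have : 0 <= `|a| * d by rewrite mulr_ge0// ltW.
    by rewrite sqrrD; lra.
  have := ler_wpM2l C0 A; lra.
Qed.

Lemma potential_exists (p : R) : 1 < p -> has_potential p.
Proof.
move=> p1.
suff H n q : 1 < q -> q <= 2 ^+ n.+1 -> has_potential q.
  apply: (H (Num.bound p)) => //; apply: ltW.
  apply: (lt_trans (archi_boundP _)); first lra.
  by rewrite -natrX ltr_nat (ltn_trans (ltn_expl _ (ltnSn 1)))// ltn_exp2l.
elim: n q => [|n IH] q q1 qn; first by apply: potential_base; rewrite q1.
have [q2|q2] := leP q 2; first by apply: potential_base; rewrite q1.
have -> : q = q / 2 * 2 by rewrite divfK.
have q21 : 1 < q / 2 by rewrite ltr_pdivlMr// mul1r.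
apply: potential_double => //; apply: IH => //.
by rewrite ler_pdivrMr// -exprSr.
Qed.

End Potentials.

(** * The inequality for sums over rotates *)

Section RieszRotations.
Variable R : realType.
Implicit Types (z w h : R[i]) (f g : R[i] -> R[i]).
Local Notation normc := (@ComplexField.Normc.normc R).

Lemma powR_add_le (p x d : R) : 0 <= p -> 0 <= x -> 0 <= d ->
  (x + d) `^ p <= 2 `^ p * (x `^ p + d `^ p).
Proof.
move=> p0 x0 d0; have two : 0 <= (2 : R) by [].
have key (a b : R) : 0 <= a -> a <= b -> (a + b) `^ p <= 2 `^ p * (a `^ p + b `^ p).
  move=> a0 ab; have b0 : 0 <= b by exact: le_trans ab.
  apply: (@le_trans _ _ ((2 * b) `^ p)); first by apply: powR_le; lra.
  by rewrite powRM// ler_wpM2l ?powR_ge0// lerDr powR_ge0.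
have [xd|/ltW dx] := leP x d; first exact: key.
by rewrite addrC [X in _ * X]addrC; exact: key.
Qed.

(** [rot_sum_ge] is applied to Phi composed with f, whose value at 0 is nonnegative because f(0) is
    real. N depends on f, r and e but not on z, so the inequality can be integrated. *)
Lemma riesz_rot_sum (p : R) : 1 < p -> exists2 C : R, 0 <= C &
  forall f (r e : R), 0 <= r -> (forall z, normc z <= r -> cdiff f z) ->
    complex.Im (f 0) = 0 -> 0 < e ->
  exists2 N, (2 < N)%N & forall z, normc z <= r ->
    rot_sum N (fun z => normc (f z) `^ p) z <=
    rot_sum N (fun z => C * `|complex.Re (f z)| `^ p + e) z.
Proof.
move=> p1; have [C C0 CP] := potential_exists p1.
have p0 : 0 < p by lra.
pose K := C * 2 `^ p.
have K0 : 0 <= K by rewrite mulr_ge0 ?powR_ge0.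
exists K => // f r e r0 df f0 e0.
have e2 : 0 < e / 2 by rewrite divr_gt0.
(* The shift d is the p-th root of t, so that it contributes K d^p <= e / 2 per term. *)
pose t := e / 2 / (K + 1); have t0 : 0 < t by rewrite !divr_gt0// ltr_wpDl.
pose d := t `^ p^-1; have d0 : 0 < d by rewrite powR_gt0.
have dp : K * d `^ p <= e / 2.
  rewrite /d -powRrM mulVf ?gt_eqF// powRr1 ?(ltW t0)// /t mulrA ler_pdivrMr ?ltr_wpDl//.
  by rewrite mulrC ler_pM2l// lerDl.
have [Phi [cP sP upP _ reP]] := CP _ d0.
have [||N0 N0P] := @rot_sum_ge _ (Phi \o f) r (e / 2) r0 e2.
- by move=> z zr; apply: cctn_compr => //; exact: df.
- move=> z zr; apply: (subharmonic_at_comp (r := r - normc z)) => //.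
    by rewrite subr_gt0.
  move=> w wz; apply: df; have := normcD (w - z) z; rewrite subrK; lra.
(* N > 2 makes the rotation angle 2 pi / N smaller than pi, which excludes the half-turn. *)
exists (maxn N0 2).+1; first by rewrite ltnS leq_maxr.
set N := (maxn N0 2).+1 => z zr.
have := N0P N _ z zr; rewrite ltnS leq_maxl => /(_ isT).
have : 0 <= Phi (f 0).
  have -> : f 0 = (complex.Re (f 0))%:C by move: f0; case: (f 0) => a b /= ->.
  exact: reP.
rewrite /= => P0 A.
have NR : 0 < N%:R :> R by rewrite ltr0n.
have B : - (N%:R * (e / 2)) <= rot_sum N (Phi \o f) z.
  apply: le_trans A; rewrite mulrBr lerDr; exact: mulr_ge0 (ltW NR) P0.
have D : rot_sum N (Phi \o f) z <=
    rot_sum N (fun z => K * `|complex.Re (f z)| `^ p + e / 2 - normc (f z) `^ p) z.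
  apply: ler_sum => k _ /=; apply: (le_trans (upP _)); rewrite lerD2r.
  set x := `|complex.Re _|.
  have := ler_wpM2l C0 (powR_add_le (ltW p0) (normr_ge0 _ : 0 <= x) (ltW d0)).
  rewrite mulrA -/K mulrDr; lra.
have E : rot_sum N (fun z => K * `|complex.Re (f z)| `^ p + e) z =
    rot_sum N (fun z => K * `|complex.Re (f z)| `^ p + e / 2 - normc (f z) `^ p) z
    + rot_sum N (fun z => normc (f z) `^ p) z + N%:R * (e / 2).
  have -> : N%:R * (e / 2) = \sum_(k < N) e / 2 by rewrite sumr_const card_ord mulr_natl.
  rewrite /rot_sum -!big_split /=; apply: eq_bigr => k _ /=; rewrite [in LHS](splitr e); ring.
rewrite E; lra.
Qed.

End RieszRotations.

(** * Shears and rotations preserve area *)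

Section AreaRotation.
Variable R : realType.
Local Notation leb := (@lebesgue_measure R).
Local Notation plane := (measurableTypeR R * measurableTypeR R)%type.
Local Notation bor := (@borel_area R).

Lemma lebesgue_translation (a : R) (A : set (measurableTypeR R)) : measurable A ->
  leb ((fun y => y + a) @^-1` A) = leb A.
Proof.
pose f : measurableTypeR R -> measurableTypeR R := fun y => y + a.
have mf : measurable_fun setT f.
  by apply: (@measurable_funD _ (measurableTypeR R) R setT idfun (cst a));
    [exact: measurable_id|exact: measurable_cst].
move=> mA; apply/esym; rewrite -[RHS]/(pushforward leb f A).
apply: (@lebesgue_measure_unique _ (pushforward leb f)) => // _ [[x y] _ <-] /=.
rewrite /pushforward (_ : f @^-1` _ = `]x - a, y - a]%classic); last first.
  by apply/seteqP; split => z; rewrite /f /= !in_itv/= ltrBlDr lerBrDr.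
rewrite !lebesgue_measure_itv /= !lte_fin ltrD2r.
by case: ifP => // _; rewrite -!EFinB; congr EFin; ring.
Qed.

(** Stated on Borel sets, where product measures compute; the completion is reached through the
    outer measure. *)
Definition preserves_area (T : plane -> plane) :=
  measurable_fun setT T /\ forall A, measurable A -> bor (T @^-1` A) = bor A.

Lemma preserves_area_comp T1 T2 : preserves_area T1 -> preserves_area T2 ->
  preserves_area (T1 \o T2).
Proof.
move=> [m1 p1] [m2 p2]; split; first exact: measurableT_comp.
move=> A mA; rewrite comp_preimage p2 ?p1//.
by rewrite -[X in measurable X]setTI; exact: m1.
Qed.

Lemma measurable_axpy (t : R) (f g : plane -> measurableTypeR R) :
  measurable_fun setT f -> measurable_fun setT g ->
  measurable_fun setT ((fun x => f x + t * g x) : plane -> measurableTypeR R).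
Proof.
move=> mf mg; apply: (@measurable_funD _ plane R setT f (fun x => t * g x)) => //.
by apply: (@measurable_funM _ plane R setT (cst t) g) => //; exact: measurable_cst.
Qed.

(** On each section with fixed first coordinate the shear is a translation. *)
Lemma shear2_preserves (t : R) : preserves_area (fun x => (x.1, x.2 + t * x.1)).
Proof.
have mT : measurable_fun [set: plane] (fun x : plane => (x.1, x.2 + t * x.1) : plane).
  apply: measurable_fun_pair => //.
  by apply: measurable_axpy.
split => // A mA; apply: eq_integral => x _ /=.
rewrite -[RHS](lebesgue_translation (t * x)); last exact: measurable_xsection.
congr leb; apply/seteqP; split => y /=; rewrite /xsection/= !inE//.
Qed.

(** Gives the other order of iterated integration, in which the horizontal shear becomes a
    translation on sections. *)
Lemma borel_area_swap A : measurable A -> bor A = (leb \x^ leb)%E A.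
Proof. by apply: product_measure_unique => //= B C mB mC; rewrite product_measure2E. Qed.

Lemma shear1_preserves (t : R) : preserves_area (fun x => (x.1 + t * x.2, x.2)).
Proof.
have mT : measurable_fun [set: plane] (fun x : plane => (x.1 + t * x.2, x.2) : plane).
  apply: measurable_fun_pair => //.
  by apply: measurable_axpy.
split => // A mA; have mTA : measurable ((fun x : plane => (x.1 + t * x.2, x.2)) @^-1` A).
  by rewrite -[X in measurable X]setTI; exact: mT.
rewrite (borel_area_swap mTA) (borel_area_swap mA).
apply: eq_integral => x _ /=.
rewrite -[RHS](lebesgue_translation (t * x)); last exact: measurable_ysection.
congr leb; apply/seteqP; split => y /=; rewrite /ysection/= !inE//.
Qed.

Definition rotation (c s : R) : plane -> plane :=
  fun x => (c * x.1 - s * x.2, s * x.1 + c * x.2).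

(* A rotation other than the half-turn is a product of three shears. *)
Lemma rotation_preserves (c s : R) : c ^+ 2 + s ^+ 2 = 1 -> c != -1 ->
  preserves_area (rotation c s).
Proof.
(* This is tan(theta / 2) for c = cos theta and s = sin theta. *)
move=> cs c1; pose t := s / (1 + c).
have c10 : 1 + c != 0 by rewrite addrC addr_eq0.
rewrite (_ : rotation c s = (fun x => (x.1 + - t * x.2, x.2)) \o
  ((fun x => (x.1, x.2 + s * x.1)) \o (fun x => (x.1 + - t * x.2, x.2)))).
  by do 2?[apply: preserves_area_comp]; exact: shear1_preserves || exact: shear2_preserves.
have s2 : s ^+ 2 = (1 - c) * (1 + c) by rewrite -subr_sqr expr1n -cs; ring.
have st : s * t = 1 - c by rewrite /t mulrA -expr2 s2 mulfK.
have tc : t * (1 + c) = s by rewrite /t divfK.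
apply/funext => -[x y]; rewrite /rotation /=; congr pair.
  have -> : x + - t * y + - t * (y + s * (x + - t * y)) =
    x - t * y - t * y - (s * t) * x + (s * t) * t * y by ring.
  by rewrite st -tc; ring.
have -> : y + s * (x + - t * y) = y + s * x - (s * t) * y by ring.
by rewrite st; ring.
Qed.

(** Countable Borel covers of B pull back to covers of the preimage with the same total area; B
    itself is arbitrary. *)
Lemma mu_ext_preimage_le T B : preserves_area T ->
  (bor^* (T @^-1` B) <= bor^* B)%mu%E.
Proof.
move=> [mT pT]; apply: le_ereal_inf_tmp => _ [F [mF BF] <-].
apply: ereal_inf_lbound; exists (fun k => T @^-1` (F k)).
  split; last by move=> x /BF[k _ Fk]; exists k.
  by move=> k; rewrite -[X in measurable X]setTI; exact: mT.
by apply: eq_eseriesr => k _; rewrite pT.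
Qed.

End AreaRotation.

(** * Invariance and measurability for the completed area *)

Section AreaIntegral.
Variable R : realType.
Local Notation normc := (@ComplexField.Normc.normc R).
Local Notation plane := (measurableTypeR R * measurableTypeR R)%type.
Local Notation bor := (@borel_area R).
Local Notation aspace := (area_space R).
Local Notation area := (@area R).

Lemma rotationK (c s : R) : c ^+ 2 + s ^+ 2 = 1 -> cancel (rotation c (- s)) (rotation c s).
Proof.
move=> cs [x y]; rewrite /rotation /=; congr pair.
  have -> : c * (c * x - - s * y) - s * (- s * x + c * y) = (c ^+ 2 + s ^+ 2) * x by ring.
  by rewrite cs mul1r.
have -> : s * (c * x - - s * y) + c * (- s * x + c * y) = (c ^+ 2 + s ^+ 2) * y by ring.
by rewrite cs mul1r.
Qed.

Lemma borel_measurable_area (A : set plane) : measurable A -> measurable (A : set aspace).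
Proof. by move=> mA; apply: sub_caratheodory; exact: sub_sigma_algebra. Qed.

Lemma area_borelE (A : set plane) : measurable A -> area A = bor A.
Proof. by move=> mA; exact: measurable_mu_extE. Qed.

Section Invariance.
Variables T S : plane -> plane.
Hypotheses (pT : preserves_area T) (pS : preserves_area S).
Hypotheses (TS : cancel T S) (ST : cancel S T).

Lemma mu_ext_preimage (B : set plane) : (bor^* (T @^-1` B) = bor^* B)%mu%E.
Proof.
apply/eqP; rewrite eq_le mu_ext_preimage_le//=.
have {1}<- : S @^-1` (T @^-1` B) = B by apply/seteqP; split => x; rewrite /= ST.
exact: mu_ext_preimage_le.
Qed.

(** Borel measurability of T does not suffice for Lebesgue measurable sets. The Caratheodory
    criterion transports instead, as T is a bijection preserving outer measure. *)
Lemma area_preimage_measurable (A : set aspace) : measurable A ->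
  measurable (T @^-1` A : set aspace).
Proof.
move=> mA; have {}mA : caratheodory_measurable (mu_ext bor) A by exact: mA.
suff : caratheodory_measurable (mu_ext bor) (T @^-1` A) by [].
move=> X; have -> : X = T @^-1` (S @^-1` X) by apply/seteqP; split => x; rewrite /= TS.
by rewrite preimage_setC -!preimage_setI !mu_ext_preimage.
Qed.

Lemma integral_area_invariant (D : set aspace) (f : aspace -> \bar R) :
  measurable D -> measurable_fun D f -> (forall x, D x -> 0 <= f x)%E ->
  T @^-1` D = D ->
  (\int[area]_(x in D) f (T x) = \int[area]_(x in D) f x)%E.
Proof.
move=> mD mf f0 TD.
have mT : measurable_fun [set: aspace] (T : aspace -> aspace).
  by move=> _ A mA; rewrite setTI; exact: area_preimage_measurable.
rewrite -{1}TD -(@ge0_integral_pushforward _ _ _ _ _ _ mT)//; last first.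
  by move=> x; rewrite inE; exact: f0.
apply: eq_measure_integral => A mA _; exact: mu_ext_preimage.
Qed.

End Invariance.

(** The product sigma-algebra is generated by rectangles, so O is written as a countable union of
    rational squares. *)
Lemma open_area_measurable (O : set (R * R)) : open O -> measurable (O : set aspace).
Proof.
move=> oO; apply: borel_measurable_area.
pose rect (a b r : rat) : set plane :=
  `](ratr a - ratr r)%R, (ratr a + ratr r)%R[%classic `*`
  `](ratr b - ratr r)%R, (ratr b + ratr r)%R[%classic.
(* Squares not contained in O are replaced by the empty set, so the union may run over all rational
   triples. *)
pose G a b r := if pselect (rect a b r `<=` O) then rect a b r else set0.
have -> : O = \bigcup_a \bigcup_b \bigcup_r G a b r.
  apply/seteqP; split => [[x y] Oxy|[x y] [a _ [b _ [r _]]]]; last first.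
    by rewrite /G; case: pselect => // h; exact: h.
  have := oO; rewrite openE => /(_ _ Oxy)/nbhs_ballP[e /= e0 eO].
  have [r] := rat_in_itvoo (divr_gt0 e0 (ltr0Sn R 1)).
  rewrite in_itv/= => /andP[r0 re].
  have near (t : R) : exists a : rat, `|t - ratr a| < ratr r.
    have tr : t < t + ratr r by rewrite ltrDl.
    have [q] := rat_in_itvoo tr; rewrite in_itv/= => /andP[q1 q2].
    by exists q; rewrite ltr_norml; lra.
  have [a ha] := near x; have [b hb] := near y.
  exists a => //; exists b => //; exists r => //; rewrite /G.
  case: pselect => [h|nh]; last first.
    exfalso; apply: nh.
    move=> [u v]; rewrite /rect => -[/=]; rewrite !in_itv/= => hu hv; apply: eO.
    by move: ha hb; rewrite !ltr_norml => ha hb; split; rewrite /ball/= ltr_norml; lra.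
  by move: ha hb; rewrite /rect !ltr_norml => ha hb; split => /=; rewrite in_itv/=; lra.
apply: bigcupT_measurable_rat => a; apply: bigcupT_measurable_rat => b.
apply: bigcupT_measurable_rat => r; rewrite /G; case: pselect => h; last exact: measurable0.
by apply: measurableX; exact: measurable_itv.
Qed.

Lemma cctn_open (D : set R[i]) (g : R[i] -> R) (a : R) :
  open (@planar R @^-1` D) -> (forall z, D z -> cctn g z) ->
  open ((@planar R @^-1` D) `&` [set x | a < g (planar x)]).
Proof.
move=> oD cg; rewrite openE => x /= [Dx ax].
have ga : 0 < g (planar x) - a by rewrite subr_gt0.
have [d d0 dP] := cg _ Dx _ ga.
apply: filterI; first by move: oD; rewrite openE => /(_ _ Dx).
apply: filterS (near_planar x d0) => y /= /dP; rewrite ltr_norml; lra.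
Qed.

Lemma cctn_measurable (D : set R[i]) (g : R[i] -> R) :
  open (@planar R @^-1` D) -> (forall z, D z -> cctn g z) ->
  measurable_fun (@planar R @^-1` D : set aspace) (g \o @planar R : aspace -> R).
Proof.
move=> oD cg mD; apply: (measurability _ (RGenOInfty.measurableE R)) => //.
move=> _ [_ [a ->] <-]; rewrite preimage_itvoy.
exact: open_area_measurable (cctn_open oD cg).
Qed.

Lemma open_unit_disc : open (@planar R @^-1` @unit_disc R).
Proof.
have -> : @planar R @^-1` @unit_disc R =
    (@planar R @^-1` setT) `&` [set x | -1 < - normc (planar x)].
  by apply/seteqP; split => x /=; rewrite ltrN2 /unit_disc /= norm_normc ltcR => // -[].
apply: (@cctn_open setT (fun z => - normc z) (-1)); first by rewrite preimage_setT; exact: openT.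
by move=> z _ e e0; have [d d0 dP] := cctn_normc z e0; exists d => // w /dP; rewrite -opprD normrN.
Qed.

Lemma cdisk_measurable (r : R) : measurable (@cdisk R r : set aspace).
Proof.
rewrite (_ : cdisk r = ~` ((@planar R @^-1` setT) `&` [set x | r < normc (planar x)])).
  apply: measurableC; apply: open_area_measurable; apply: (@cctn_open setT normc r).
    by rewrite preimage_setT; exact: openT.
  by move=> z _; exact: cctn_normc.
apply/seteqP; split => x; rewrite /cdisk /=.
  by move=> xr [_]; rewrite ltNge xr.
by move=> /not_andP[//|/negP]; rewrite -leNgt.
Qed.

Lemma cdisk_finite (r : R) : (area (@cdisk R r) < +oo)%E.
Proof.
pose I : set (measurableTypeR R) := `[(- r)%R, r]%classic.
have mI : measurable I by exact: measurable_itv.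
have sub : cdisk r `<=` I `*` I.
  move=> x; rewrite /cdisk /= => xr.
  have := le_trans (Re_le_normc _) xr; have := le_trans (Im_le_normc _) xr.
  by rewrite !ler_norml/= => yr xr'; split; rewrite /I /= in_itv.
apply: (@le_lt_trans _ _ (area (I `*` I))).
  by apply: le_measure; rewrite ?inE//; [exact: cdisk_measurable|
    by apply: borel_measurable_area; exact: measurableX].
rewrite area_borelE; last exact: measurableX.
have -> : bor (I `*` I) = (lebesgue_measure I * lebesgue_measure I)%E.
  exact: product_measure1E.
rewrite /I lebesgue_measure_itv/=.
by case: ifP => _; rewrite ?mul0e ?ltry// -EFinM ltry.
Qed.

End AreaIntegral.

(** * Integration against a bounded radial weight on a closed disc *)

Section WeightedRiesz.
Variable R : realType.
Implicit Types (z w h : R[i]) (f g : R[i] -> R[i]).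
Local Notation normc := (@ComplexField.Normc.normc R).
Local Notation plane := (measurableTypeR R * measurableTypeR R)%type.
Local Notation aspace := (area_space R).
Local Notation area := (@area R).

Definition root_turn (N : nat) : plane -> plane :=
  rotation (cos (pi *+ 2 / N%:R)) (sin (pi *+ 2 / N%:R)).
Definition root_turn_inv (N : nat) : plane -> plane :=
  rotation (cos (pi *+ 2 / N%:R)) (- sin (pi *+ 2 / N%:R)).

Lemma planar_root_turn N k (x : plane) :
  planar (iter k (root_turn N) x) = zroot R N ^+ k * planar x.
Proof.
elim: k => [|k IH]; first by rewrite expr0 mul1r.
rewrite iterS exprS -mulrA -IH; set y := iter _ _ _; case: y => a b.
by rewrite /planar /zroot /cexp /= expR0 !mul1r; apply/eqP; rewrite eq_complex/= eqxx addrC eqxx.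
Qed.

Lemma root_turn_preserves N : (2 < N)%N ->
  preserves_area (root_turn N) /\ preserves_area (root_turn_inv N).
Proof.
move=> N2; set t : R := pi *+ 2 / N%:R.
have NR : 2 < N%:R :> R by rewrite (ltr_nat R 2).
have p0 := pi_gt0 R.
have t0 : 0 <= t by rewrite divr_ge0// mulrn_wge0// ltW.
have tpi : t < pi.
  rewrite /t ltr_pdivrMr; last lra.
  by rewrite -[pi *+ 2]mulr_natr ltr_pM2l.
have c1 : cos t != -1.
  apply/eqP => ct; have := @cosK R t; rewrite ct acosN1 in_itv/= t0 (ltW tpi).
  by move=> /(_ isT) E; move: tpi; rewrite E ltxx.
by split; apply: rotation_preserves => //; rewrite ?sqrrN cos2Dsin2.
Qed.

Lemma preserves_area_iter T k : preserves_area T -> @preserves_area R (iter k T).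
Proof.
move=> pT; elim: k => [|k IH]; last exact: preserves_area_comp pT IH.
by split => //; exact: measurable_id.
Qed.

Lemma iter_cancel (A : Type) (T S : A -> A) k : cancel T S -> cancel (iter k T) (iter k S).
Proof. by move=> TS; elim: k => [//|k IH] x; rewrite iterSr iterS TS IH. Qed.

Lemma iter_root_turn_cdisk N k r : iter k (root_turn N) @^-1` (cdisk r) = cdisk r.
Proof.
by apply/seteqP; split => x; rewrite /cdisk /= planar_root_turn normc_rot_expn.
Qed.

Section Disk.
Variables (r : R) (W : R[i] -> R).
Let K : set aspace := cdisk r.
Hypotheses (mW : measurable_fun K (W \o @planar R : aspace -> R))
  (W0 : forall z, normc z <= r -> 0 <= W z)
  (Wrad : forall z w, normc z <= r -> normc z = normc w -> W z = W w).

Let mK : measurable K. Proof. exact: cdisk_measurable. Qed.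

Lemma root_turnK N : cancel (@root_turn N) (root_turn_inv N) /\
  cancel (root_turn_inv N) (root_turn N).
Proof.
have cs : cos (pi *+ 2 / N%:R) ^+ 2 + sin (pi *+ 2 / N%:R) ^+ 2 = 1 :> R.
  exact: cos2Dsin2.
split; last exact: rotationK.
have := @rotationK R (cos (pi *+ 2 / N%:R)) (- sin (pi *+ 2 / N%:R)).
by rewrite sqrrN opprK => /(_ cs).
Qed.

Lemma measurable_root_turn N k d (Y : measurableType d) (h : aspace -> Y) : (2 < N)%N ->
  measurable_fun K h -> measurable_fun K (fun x : aspace => h (iter k (root_turn N) x)).
Proof.
move=> N2 mh; have [pT pS] := root_turn_preserves N2; have [TS ST] := root_turnK N.
apply: (measurable_comp mK _ mh).
  by move=> _ [x Kx <-]; rewrite -[K](iter_root_turn_cdisk N k r) in Kx; exact: Kx.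
apply: measurable_funTS => _ A mA; rewrite setTI.
exact: (area_preimage_measurable (preserves_area_iter k pT) (preserves_area_iter k pS)
  (iter_cancel k TS) (iter_cancel k ST)).
Qed.

Lemma rot_sum_weighted N (F : R[i] -> R) (x : plane) : K x ->
  rot_sum N F (planar x) * W (planar x) =
  \sum_(k < N) (F (planar (iter k (root_turn N) x)) * W (planar (iter k (root_turn N) x))).
Proof.
move=> Kx; rewrite /rot_sum mulr_suml; apply: eq_bigr => k _.
rewrite planar_root_turn; congr (_ * _); apply: Wrad => //.
by rewrite normc_rot_expn.
Qed.

Lemma measurable_rot_sum N (F : R[i] -> R) : (2 < N)%N ->
  measurable_fun K (F \o @planar R : aspace -> R) ->
  measurable_fun K (fun x : aspace => (rot_sum N F (planar x) * W (planar x))%:E).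
Proof.
move=> N2 mF; apply/measurable_EFinP.
apply: (@measurable_funM _ aspace R K (fun x => rot_sum N F (planar x))
  (W \o @planar R)); last exact: mW.
apply: (@eq_measurable_fun _ _ _ _ K
  (fun x : aspace => \sum_(k < N) F (planar (iter k (root_turn N) x)))).
  by move=> x _; apply: eq_bigr => k _; rewrite planar_root_turn.
by apply: measurable_sum => k; exact: (measurable_root_turn k N2 mF).
Qed.

(** The area, the disc and W are all invariant under the rotation, so the N terms have equal
    integrals. *)
Lemma integral_rot_sum N (F : R[i] -> R) : (2 < N)%N ->
  measurable_fun K (F \o @planar R : aspace -> R) ->
  (forall z, normc z <= r -> 0 <= F z) ->
  (\int[area]_(x in K) (rot_sum N F (planar x) * W (planar x))%:E =
   N%:R%:E * \int[area]_(x in K) (F (planar x) * W (planar x))%:E)%E.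
Proof.
move=> N2 mF F0.
pose h (x : aspace) : \bar R := (F (planar x) * W (planar x))%:E.
have h0 x : K x -> (0 <= h x)%E by move=> Kx; rewrite lee_fin mulr_ge0 ?F0 ?W0.
have mh : measurable_fun K h by apply/measurable_EFinP; apply: measurable_funM.
have [pT pS] := root_turn_preserves N2; have [TS ST] := root_turnK N.
have hk k : (\int[area]_(x in K) h (iter k (root_turn N) x) = \int[area]_(x in K) h x)%E.
  apply: (integral_area_invariant (preserves_area_iter k pT) (preserves_area_iter k pS)
    (iter_cancel k TS) (iter_cancel k ST)) => //.
  exact: iter_root_turn_cdisk.
transitivity (\int[area]_(x in K) \sum_(k < N) h (iter k (root_turn N) x))%E.
  by apply: eq_integral => x; rewrite inE => Kx; rewrite sumEFin rot_sum_weighted.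
have mhk k : measurable_fun K (fun x : aspace => h (iter k (root_turn N) x)).
  exact: measurable_root_turn.
have hk0 k (x : aspace) : K x -> (0 <= h (iter k (root_turn N) x))%E.
  move=> Kx; apply: h0; move: Kx.
  by rewrite /K -{1}(iter_root_turn_cdisk N k r).
rewrite (ge0_integral_sum area mK (fun k : 'I_N => mhk k) (fun k : 'I_N => hk0 k)).
rewrite (eq_bigr (fun=> \int[area]_(x in K) h x)%E); last by move=> k _; exact: hk.
by rewrite sumr_const card_ord mule_natl.
Qed.

(** Integrating the inequality of sums and dividing by N removes the rotations. The remaining error
    is at most d M times the finite area of the disc. *)
Lemma integral_le_of_rot_sum (M : R) (F G : R[i] -> R) :
  (forall z, normc z <= r -> W z <= M) ->
  measurable_fun K (F \o @planar R : aspace -> R) ->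
  measurable_fun K (G \o @planar R : aspace -> R) ->
  (forall z, normc z <= r -> 0 <= F z) -> (forall z, normc z <= r -> 0 <= G z) ->
  (forall e, 0 < e -> exists2 N, (2 < N)%N & forall z, normc z <= r ->
     rot_sum N F z <= rot_sum N (fun z => G z + e) z) ->
  (\int[area]_(x in K) (F (planar x) * W (planar x))%:E <=
   \int[area]_(x in K) (G (planar x) * W (planar x))%:E)%E.
Proof.
move=> WM mF mG F0 G0 FG; apply/lee_addgt0Pr => e e0.
have Kfin : area K \is a fin_num.
  by rewrite ge0_fin_numE; [exact: cdisk_finite|exact: measure_ge0].
pose A := fine (area K); have A0 : 0 <= A by rewrite fine_ge0.
pose M' := `|M|; have M'0 : 0 <= M' by exact: normr_ge0.
(* Gives d M' A <= e; the added 1 avoids a zero denominator. *)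
pose d := e / (M' * A + 1).
have MA : 0 < M' * A + 1 by rewrite ltr_wpDl// mulr_ge0.
have d0 : 0 < d by rewrite divr_gt0.
have [N N2 NP] := FG d d0.
have mGd : measurable_fun K ((fun z => G z + d) \o @planar R : aspace -> R).
  by apply: (@measurable_funD _ aspace R K (G \o @planar R) (cst d)) => //;
    exact: measurable_cst.
have mFW : measurable_fun K (fun x : aspace => (F (planar x) * W (planar x))%:E).
  by apply/measurable_EFinP; apply: measurable_funM.
have mGW : measurable_fun K (fun x : aspace => (G (planar x) * W (planar x))%:E).
  by apply/measurable_EFinP; apply: measurable_funM.
have mGdW : measurable_fun K (fun x : aspace => ((G (planar x) + d) * W (planar x))%:E).
  by apply/measurable_EFinP; apply: measurable_funM.
apply: (@le_trans _ _ (\int[area]_(x in K) ((G (planar x) + d) * W (planar x))%:E)%E).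
  have NR : (0 < N%:R%:E :> \bar R)%E by rewrite lte_fin ltr0n (leq_trans _ N2).
  rewrite -(@lee_pmul2l _ N%:R%:E)// -(integral_rot_sum N2 mF F0).
  rewrite -(integral_rot_sum N2 mGd); last first.
    by move=> z zr; rewrite addr_ge0 ?G0// ltW.
  have nn H z : (forall z, normc z <= r -> 0 <= H z) -> normc z <= r -> 0 <= rot_sum N H z.
    by move=> H0 zr; apply: sumr_ge0 => k _; rewrite H0// normc_rot_expn.
  apply: (@ge0_le_integral _ _ _ area K mK).
  - by move=> x Kx; rewrite lee_fin mulr_ge0 ?W0// nn.
  - exact: measurable_rot_sum.
  - exact: measurable_rot_sum.
  - by move=> x Kx; rewrite lee_fin ler_wpM2r ?W0// NP.
have mc : measurable_fun K (fun _ : aspace => (d * M')%:E) by exact: measurable_cst.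
apply: (@le_trans _ _ (\int[area]_(x in K) ((G (planar x) * W (planar x))%:E + (d * M')%:E))%E).
  apply: (@ge0_le_integral _ _ _ area K mK).
  - by move=> x Kx; rewrite lee_fin mulr_ge0 ?W0// addr_ge0 ?G0// ltW.
  - exact: mGdW.
  - exact: emeasurable_funD.
  - move=> x Kx; rewrite -EFinD lee_fin mulrDl lerD2l ler_pM2l//.
    exact: le_trans (WM _ Kx) (ler_norm _).
have GW0 x : K x -> (0 <= (G (planar x) * W (planar x))%:E)%E.
  by move=> Kx; rewrite lee_fin mulr_ge0 ?W0 ?G0.
have c0 (x : aspace) : K x -> (0 <= (d * M')%:E)%E.
  by move=> _; rewrite lee_fin mulr_ge0// ltW.
rewrite (ge0_integralD area mK GW0 mGW c0 mc).
rewrite leeD2l// integral_cst// -[area K]fineK// -EFinM lee_fin -/A.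
have -> : d * M' * A = e * ((M' * A) / (M' * A + 1)) by rewrite /d; ring.
by rewrite ger_pMr// ler_pdivrMr// mul1r lerDl.
Qed.

End Disk.

End WeightedRiesz.

(** * Exhaustion of the domain and monotone convergence *)

Section Conclusion.
Variable R : realType.
Implicit Types (z w h : R[i]) (f g : R[i] -> R[i]).
Local Notation normc := (@ComplexField.Normc.normc R).
Local Notation aspace := (area_space R).
Local Notation area := (@area R).

Lemma disk_exhaustion (D : set R[i]) : D = @unit_disc R \/ D = setT ->
  exists rho : nat -> R, [/\ forall n, 0 <= rho n, {homo rho : m n / (m <= n)%N >-> m <= n},
    forall n z, normc z <= rho n -> D z &
    forall z, D z -> exists n, normc z <= rho n].
Proof.
case=> ->; last first.
  exists (fun n => n%:R); split => // [m n mn|z _]; first by rewrite ler_nat.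
  by exists (Num.bound (normc z)); apply: ltW; apply: archi_boundP; exact: normc_ge0.
have i0 n : 0 < (n.+1%:R : R)^-1 by rewrite invr_gt0.
exists (fun n => 1 - n.+1%:R^-1); split.
- by move=> n; rewrite subr_ge0 invf_le1// ler1n.
- by move=> m n mn; rewrite lerD2l lerN2 lef_pV2 ?posrE// ler_nat ltnS.
- move=> n z zn; rewrite /unit_disc/= norm_normc ltcR; apply: (le_lt_trans zn).
  by rewrite ltrBlDr ltrDl.
- move=> z; rewrite /unit_disc/= norm_normc ltcR => z1.
  have z10 : 0 < 1 - normc z by rewrite subr_gt0.
  exists (Num.bound (1 - normc z)^-1).
  rewrite lerBrDr addrC -lerBrDr -[leRHS]invrK lef_pV2 ?posrE ?invr_gt0//.
  apply: ltW; apply: (lt_le_trans (archi_boundP _)); first by rewrite invr_ge0 ltW.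
  by rewrite ler_nat.
Qed.

Lemma weighted_riesz (p : R) : 1 < p -> exists2 C : R, 0 <= C &
  forall (D : set R[i]) (w : R[i] -> R) f, D = @unit_disc R \/ D = setT ->
    radial_weight D w -> analytic D f -> complex.Im (f 0) = 0 ->
  (\int[area]_(x in @planar R @^-1` D) (normc (f (planar x)) `^ p * w (planar x))%:E <=
   C%:E * \int[area]_(x in @planar R @^-1` D)
     (normc (re_part f (planar x)) `^ p * w (planar x))%:E)%E.
Proof.
move=> p1; have [C C0 CP] := riesz_rot_sum p1; exists C => //.
move=> D w f hD [mw w0 wrad] af f0.
have df z : D z -> cdiff f z by move=> Dz; apply: derivable_cdiff; exact: af.
have oD : open (@planar R @^-1` D).
  case: hD => ->; [exact: open_unit_disc|by rewrite preimage_setT; exact: openT].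
have [rho [rho0 rhoM rhoD Drho]] := disk_exhaustion hD.
pose D' : set aspace := @planar R @^-1` D.
have mD : measurable D' by exact: open_area_measurable.
pose K n : set aspace := cdisk (rho n).
have mK n : measurable (K n) by exact: cdisk_measurable.
have KD n : K n `<=` D' by move=> x; exact: rhoD.
pose F z := normc (f z) `^ p; pose G z := C * `|complex.Re (f z)| `^ p.
have F0 z : 0 <= F z by exact: powR_ge0.
have G0 z : 0 <= G z by rewrite mulr_ge0 ?powR_ge0.
have mF : measurable_fun D' (F \o @planar R : aspace -> R).
  have mn : measurable_fun D' ((normc \o f) \o @planar R : aspace -> R).
    by apply: cctn_measurable => // z Dz; apply: cctn_compr; [exact: df|exact: cctn_normc].
  exact: (measurableT_comp (@measurable_powR R p) mn).
have mRe : measurable_fun D'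
    ((fun z => `|complex.Re (f z)| `^ p) \o @planar R : aspace -> R).
  have mr : measurable_fun D' (((fun z => `|complex.Re z|) \o f) \o @planar R : aspace -> R).
    by apply: cctn_measurable => // z Dz; apply: cctn_compr; [exact: df|exact: cctn_absRe].
  exact: (measurableT_comp (@measurable_powR R p) mr).
have mG : measurable_fun D' (G \o @planar R : aspace -> R).
  by apply: (@measurable_funM _ aspace R D' (cst C)) => //; exact: measurable_cst.
(* A bounded weight on the compact disc [K n] has finite mass, whether or not w is locally
   integrable. *)
pose W n z := Num.min (w z) n%:R.
have W0 n z : D z -> 0 <= W n z by move=> Dz; rewrite /W le_min w0//=.
have mW n : measurable_fun D' (W n \o @planar R : aspace -> R).
  by apply: (@measurable_minr _ aspace R D' (w \o @planar R) (cst n%:R)) => //;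
    exact: measurable_cst.
pose H x : \bar R := (normc (re_part f (planar x)) `^ p * w (planar x))%:E.
have HE x : H x = (`|complex.Re (f (planar x))| `^ p * w (planar x))%:E.
  by rewrite /H /re_part normc_real.
have H0 (x : aspace) : D' x -> (0 <= H x)%E.
  by move=> Dx; rewrite lee_fin mulr_ge0 ?powR_ge0 ?w0.
have mH : measurable_fun D' (H : aspace -> \bar R).
  rewrite (funext HE); apply/measurable_EFinP.
  exact: (@measurable_funM _ aspace R D' _ (w \o @planar R)).
(* The bound on the right is already taken over all of D with the full weight, hence is independent
   of n. *)
have step n : (\int[area]_(x in K n) (F (planar x) * W n (planar x))%:E <=
    C%:E * \int[area]_(x in D') H x)%E.
  apply: (@le_trans _ _ (\int[area]_(x in K n) (G (planar x) * W n (planar x))%:E)%E).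
    apply: (@integral_le_of_rot_sum R (rho n) (W n) _ _ _ n%:R).
    - exact: (measurable_funS mD (@KD n) (mW n)).
    - by move=> z /rhoD; exact: W0.
    - move=> z z' zr zz'; rewrite /W wrad ?(wrad z')//; first by rewrite !norm_normc zz'.
        by apply: (rhoD n); rewrite -zz'.
      exact: rhoD zr.
    - by move=> z _; rewrite /W ge_min lexx orbT.
    - exact: (measurable_funS mD (@KD n) mF).
    - exact: (measurable_funS mD (@KD n) mG).
    - by [].
    - by [].
    - move=> e e0; apply: CP => // z /rhoD; exact: df.
  rewrite -(ge0_integralZl_EFin area mD H0 mH C0).
  have mCH : measurable_fun D' (fun x : aspace => (C%:E * H x)%E) by exact: measurable_funeM.
  have CH0 (x : aspace) : D' x -> (0 <= C%:E * H x)%E.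
    by move=> Dx; apply: mule_ge0; [rewrite lee_fin|exact: H0].
  apply: (@le_trans _ _ (\int[area]_(x in K n) (C%:E * H x))%E).
    apply: (@ge0_le_integral _ _ _ area (K n) (mK n)).
    - by move=> x /KD Dx; rewrite lee_fin mulr_ge0 ?W0.
    - apply/measurable_EFinP; apply: (measurable_funS mD (@KD n)).
      exact: (@measurable_funM _ aspace R D' (G \o @planar R) (W n \o @planar R)).
    - exact: (measurable_funS mD (@KD n) mCH).
    - move=> x /KD Dx; rewrite HE -EFinM lee_fin mulrA ler_wpM2l//.
      by rewrite /W ge_min lexx.
  exact: (ge0_subset_integral area (mK n) mD mCH CH0 (@KD n)).
(* Extended by zero outside [K n], these functions increase with n, and at each point of D they are
   eventually equal to F w. *)
pose g n : aspace -> \bar R := (fun x => (F (planar x) * W n (planar x))%:E) \_ (K n).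
have FW0 n (x : aspace) : D' x -> (0 <= (F (planar x) * W n (planar x))%:E)%E.
  by move=> Dx; rewrite lee_fin mulr_ge0 ?W0.
have mg n : measurable_fun D' (g n).
  apply: measurable_funTS; apply/(measurable_restrictT _ (mK n)).
  apply/measurable_EFinP; apply: (measurable_funS mD (@KD n)).
  exact: (@measurable_funM _ aspace R D' (F \o @planar R) (W n \o @planar R)).
have g0 n (x : aspace) : D' x -> (0 <= g n x)%E.
  by move=> Dx; rewrite /g patchE; case: ifP => // _; exact: FW0.
have ndg (x : aspace) : D' x -> nondecreasing_seq (g^~ x).
  move=> Dx m n mn; rewrite /g !patchE; case: ifPn => [xm|_]; last exact: g0.
  have -> : x \in K n.
    by move: xm; rewrite !inE /K /cdisk /= => /le_trans; apply; exact: rhoM.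
  rewrite lee_fin ler_wpM2l// /W le_min ge_min lexx/=.
  by rewrite ge_min (ler_nat R) mn orbT.
have limg (x : aspace) : D' x -> limn (g^~ x) = (F (planar x) * w (planar x))%:E.
  move=> Dx; have [m mx] := Drho _ Dx; apply: lim_near_cst => //.
  exists (maxn m (Num.bound (w (planar x)))) => // n /=; rewrite geq_max => /andP[mn wn].
  rewrite /g patchE ifT; last first.
    by rewrite inE /K /cdisk /=; apply: (le_trans mx); exact: rhoM.
  rewrite /W min_l//; apply: ltW; apply: (lt_le_trans (archi_boundP (w0 _ Dx))).
  by rewrite ler_nat.
rewrite -/D' (eq_integral (fun x => limn (g^~ x))); last first.
  by move=> x; rewrite inE => /limg ->.
rewrite (monotone_convergence area mD mg g0 ndg).
apply: lime_le.
  apply: ereal_nondecreasing_is_cvgn => m n mn.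
  apply: (@ge0_le_integral _ _ _ area D' mD) => //; first exact: g0.
  by move=> x Dx; exact: ndg.
apply: nearW => n; rewrite /g -integral_mkcondr setIidr//.
Qed.

End Conclusion.

End Riesz.

(** * From functions to operator norms *)

Theorem theorem6p1 (R : realType) (p : R) (p_gt1 : 1 < p) :
  exists c : R,
    forall (D : set R[i]) (hD : D = @unit_disc R \/ D = setT)
      (w : R[i] -> R) (hw : radial_weight D w)
      (X : Type) (x0 : X) (N : X -> R) (N_gt0 : forall x, x <> x0 -> 0 < N x)
      (A : X -> R[i] -> R[i]) (hA : forall x, bergman p D w (A x))
      (hA0 : forall x, complex.Im (A x 0) = 0),
      bounded_op p D w x0 N (re_bergman p D w) (fun x => re_part (A x)) ->
      bounded_op p D w x0 N (bergman p D w) A /\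
      (op_norm p D w x0 N A <=
         c%:E * op_norm p D w x0 N (fun x => re_part (A x)))%E.
Proof.
have [C C0 CP] := weighted_riesz p_gt1.
(* C compares integrals of p-th powers, so its p-th root compares norms; it was obtained from p
   alone. *)
exists (C `^ p^-1) => D hD w hw X x0 N N_gt0 A hA hA0 [_ ReA].
have p0 : 0 <= p^-1 by rewrite invr_ge0; exact: le_trans ler01 (ltW p_gt1).
have c0 : 0 <= C `^ p^-1 by exact: powR_ge0.
have [_ w0 _] := hw.
have int0 (f : R[i] -> R[i]) : (0 <= \int[@area R]_(xy in @planar R @^-1` D)
    (ComplexField.Normc.normc (f (planar xy)) `^ p * w (planar xy))%:E)%E.
  by apply: integral_ge0 => x Dx; rewrite lee_fin mulr_ge0 ?powR_ge0 ?w0.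
have norm_le x : (wnorm p D w (A x) <= (C `^ p^-1)%:E * wnorm p D w (re_part (A x)))%E.
  rewrite /wnorm -poweR_EFin -poweRM ?lee_fin//.
  have mem (y : \bar R) : (0 <= y)%E -> y \in `[0%E, +oo%E]%R.
    by move=> y0; rewrite in_itv/= y0 leey.
  apply: gt0_ler_poweR p0 _ _ _ _ _; [exact/mem/int0| |].
    by apply: mem; apply: mule_ge0; [rewrite lee_fin|exact: int0].
  by apply: CP => //; have [] := hA x.
have opA : (op_norm p D w x0 N A <=
    (C `^ p^-1)%:E * op_norm p D w x0 N (fun x => re_part (A x)))%E.
  apply: ge_ereal_sup => _ [->|[x xx0 <-]].
    rewrite mule_ge0 ?lee_fin//; apply: ereal_sup_ubound; by left.
  apply: (@le_trans _ _ ((C `^ p^-1)%:E * (wnorm p D w (re_part (A x)) * ((N x)^-1)%:E))%E).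
    rewrite muleA; apply: lee_wpmul2r; last exact: norm_le.
    by rewrite lee_fin invr_ge0 ltW// N_gt0.
  apply: lee_wpmul2l; first by rewrite lee_fin.
  by apply: ereal_sup_ubound; right; exists x.
split; last exact: opA.
split; first exact: hA.
apply: (le_lt_trans opA).
have op0 : (0 <= op_norm p D w x0 N (fun x => re_part (A x)))%E.
  by apply: ereal_sup_ubound; left.
by apply: lte_mul_pinfty => //; rewrite lee_fin.
Qed.
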